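(* Let $\boldsymbol{P}$ be an M/G/1-type stochastic matrix with blocks $\{\boldsymbol{A}_k\}_{k\ge -1}$, $\{\boldsymbol{B}_k\}_{k\ge -1}$, let $\boldsymbol{\pi}=(\boldsymbol{\pi}_0,\boldsymbol{\pi}_1,\dots)$ be its stationary distribution vector, and let $\boldsymbol{\pi}^{(N)}=(\boldsymbol{\pi}^{(N)}_0,\boldsymbol{\pi}^{(N)}_1,\dots)$, $N\in\mathbb{N}$, be its level-increment truncation approximation (all as defined in the context). Suppose that the following hold. (1) (i) $\boldsymbol{P}$ is irreducible; (ii) $\boldsymbol{A}:=\sum_{k=-1}^\infty \boldsymbol{A}_k$ is an irreducible stochastic matrix; (iii) $\overline{\boldsymbol{m}}_B:=\sum_{k=1}^\infty k\boldsymbol{B}_k\boldsymbol{e}$ is finite; (iv) $\sigma:=\boldsymbol{\varpi}\,\overline{\boldsymbol{m}}_A<0$, where $\overline{\boldsymbol{m}}_A=\sum_{k=-1}^\infty k\boldsymbol{A}_k\boldsymbol{e}$ and $\boldsymbol{\varpi}$ is the unique stationary distribution (row) vector of $\boldsymbol{A}$. (2) The single communication class of the matrix $\boldsymbol{G}$ is aperiodic. (3) $r:=\min(r_A,r_B)>1$, where $r_A=\sup\{z\ge 1:\sum_{k=1}^\infty z^k\boldsymbol{A}_k<\infty\}$ and $r_B=\sup\{z\ge 1:\sum_{k=1}^\infty z^k\boldsymbol{B}_k<\infty\}$. (4) There exists a nonnegative function $f$ on $\mathbb{Z}_+$ such that $$\lim_{N\to\infty}\frac{\overline{\overline{\boldsymbol{A}}}_N\boldsymbol{e}}{r^{-N}f(N)}=\boldsymbol{c}_A,\qquad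 \lim_{N\to\infty}\frac{\overline{\overline{\boldsymbol{B}}}_N\boldsymbol{e}}{r^{-N}f(N)}=\boldsymbol{c}_B,\qquad \lim_{N\to\infty}\frac{f(N)}{f(N-1)}=1,$$ where $\boldsymbol{c}_A\ge\boldsymbol{0}$ and $\boldsymbol{c}_B\ge\boldsymbol{0}$ are finite column vectors of dimensions $M_1$ and $M_0$, respectively, at least one of which is non-zero (in particular $r<\infty$ and $f(N)>0$ for all sufficiently large $N$, so that the quotients make sense). Then, for every $k\in\mathbb{Z}_+$, $$\lim_{N\to\infty}\frac{\boldsymbol{\pi}^{(N)}_k-\boldsymbol{\pi}_k}{r^{-N}f(N)}=\frac{r(\boldsymbol{\pi}_0\boldsymbol{c}_B+\overline{\boldsymbol{\pi}}_0\boldsymbol{c}_A)}{-\sigma}\,\boldsymbol{\pi}_k>\boldsymbol{0},$$ where $\overline{\boldsymbol{\pi}}_0=\sum_{\ell=1}^\infty\boldsymbol{\pi}_\ell$.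
   Context: Notation: $\mathbb{N}=\{1,2,\dots\}$, $\mathbb{Z}_+=\{0,1,2,\dots\}$; $\boldsymbol{e}$ is the column vector of ones of appropriate dimension; $\boldsymbol{O}$ is the zero matrix; vector inequalities and limits are entrywise; for a nonnegative matrix $\boldsymbol{X}$, $\boldsymbol{X}<\infty$ means every entry is finite. M/G/1-type matrix: Let $M_0,M_1\in\mathbb{N}$, $\mathbb{L}_0=\{0\}\times\{1,\dots,M_0\}$, $\mathbb{L}_k=\{k\}\times\{1,\dots,M_1\}$ for $k\in\mathbb{N}$, and $\mathbb{S}=\bigcup_{k\ge0}\mathbb{L}_k$. The matrix $\boldsymbol{P}$ is a stochastic matrix on $\mathbb{S}$ with block form (blocks indexed by levels $\mathbb{L}_0,\mathbb{L}_1,\dots$) $$\boldsymbol{P}=\begin{pmatrix}\boldsymbol{B}_0&\boldsymbol{B}_1&\boldsymbol{B}_2&\boldsymbol{B}_3&\cdots\\ \boldsymbol{B}_{-1}&\boldsymbol{A}_0&\boldsymbol{A}_1&\boldsymbol{A}_2&\cdots\\ \boldsymbol{O}&\boldsymbol{A}_{-1}&\boldsymbol{A}_0&\boldsymbol{A}_1&\cdots\\ \boldsymbol{O}&\boldsymbol{O}&\boldsymbol{A}_{-1}&\boldsymbol{A}_0&\cdots\\ \vdots&\vdots&\vdots&\vdots&\ddots\end{pmatrix},$$ where the $\boldsymbol{A}_k$ are $M_1\times M_1$, $\boldsymbol{B}_0$ is $M_0\times M_0$, $\boldsymbol{B}_{-1}$ is $M_1\times M_0$, and $\boldsymbol{B}_k$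 ($k\ge1$) is $M_0\times M_1$, all nonnegative. Under hypothesis (1), $\boldsymbol{P}$ is irreducible and positive recurrent; its unique stationary distribution (row) vector is partitioned by levels as $\boldsymbol{\pi}=(\boldsymbol{\pi}_0,\boldsymbol{\pi}_1,\boldsymbol{\pi}_2,\dots)$. Tails: for $k\in\mathbb{Z}_+$, $\overline{\boldsymbol{A}}_k=\sum_{\ell=k+1}^\infty\boldsymbol{A}_\ell$, $\overline{\boldsymbol{B}}_k=\sum_{\ell=k+1}^\infty\boldsymbol{B}_\ell$, $\overline{\overline{\boldsymbol{A}}}_k=\sum_{\ell=k+1}^\infty\overline{\boldsymbol{A}}_\ell$, $\overline{\overline{\boldsymbol{B}}}_k=\sum_{\ell=k+1}^\infty\overline{\boldsymbol{B}}_\ell$. The matrix $\boldsymbol{G}$ is the minimal nonnegative solution of $\boldsymbol{G}=\sum_{m=-1}^\infty\boldsymbol{A}_m\boldsymbol{G}^{m+1}$. Under hypothesis (1), $\boldsymbol{G}$ is a stochastic matrix with a single communication class (i.e. exactly one closed communicating class, possibly together with transient states). Level-increment (LI) truncation approximation: for $N\in\mathbb{N}$, let $\boldsymbol{A}^{(N)}_k=\boldsymbol{A}_k$ for $-1\le k\le N-1$, $\boldsymbol{A}^{(N)}_N=\overline{\boldsymbol{A}}_{N-1}=\sum_{\ell=N}^\infty\boldsymbol{A}_\ell$, $\boldsymbol{A}^{(N)}_k=\boldsymbol{O}$ for $k\ge N+1$, and similarly $\boldsymbol{B}^{(N)}_k=\boldsymbol{B}_k$ for $-1\le k\le N-1$,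 $\boldsymbol{B}^{(N)}_N=\overline{\boldsymbol{B}}_{N-1}=\sum_{\ell=N}^\infty\boldsymbol{B}_\ell$, $\boldsymbol{B}^{(N)}_k=\boldsymbol{O}$ for $k\ge N+1$. Let $\boldsymbol{P}^{(N)}$ be the stochastic matrix obtained from $\boldsymbol{P}$ by replacing each $\boldsymbol{A}_k,\boldsymbol{B}_k$ with $\boldsymbol{A}^{(N)}_k,\boldsymbol{B}^{(N)}_k$. Under hypothesis (1), $\boldsymbol{P}^{(N)}$ has a unique stationary distribution vector, denoted $\boldsymbol{\pi}^{(N)}=(\boldsymbol{\pi}^{(N)}_0,\boldsymbol{\pi}^{(N)}_1,\dots)$ (partitioned by levels). *)

(* Defs.v *)
From HB Require Import structures.
From mathcomp Require Import all_boot all_order all_algebra.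
From mathcomp Require Import all_classical all_reals all_analysis.

Set Implicit Arguments.
Unset Strict Implicit.
Unset Printing Implicit Defensive.

Import Order.TTheory GRing.Theory Num.Theory.
Import numFieldNormedType.Exports.

Local Open Scope classical_set_scope.
Local Open Scope ring_scope.

Section CountableChain.
Variables (R : realType) (S : choiceType).
Implicit Types (P : S -> S -> R) (p : S -> R).

Definition stochastic P : Prop :=
  (forall s t, 0 <= P s t) /\
  (forall s, \esum_(t in [set: S]) (P s t)%:E = 1%E).

Fixpoint nstep P (n : nat) (s t : S) : \bar R :=
  if n is n'.+1 then (\esum_(u in [set: S]) ((P s u)%:E * nstep P n' u t))%E
  else (s == t)%:R%:E.

Definition irreducible P : Prop :=
  forall s t, exists n, (0 < nstep P n s t)%E.

Definition stationary P p : Prop :=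
  [/\ forall s, 0 <= p s,
      \esum_(s in [set: S]) (p s)%:E = 1%E &
      forall t, \esum_(s in [set: S]) (p s * P s t)%:E = (p t)%:E].

End CountableChain.

Section FiniteMatrix.
Variables (R : realType) (n : nat).
Implicit Types (X : 'M[R]_n) (v : 'rV[R]_n) (C : {set 'I_n}).

Definition mxle (m q : nat) (X Y : 'M[R]_(m, q)) : Prop :=
  forall i j, X i j <= Y i j.

Definition stochastic_mx X : Prop :=
  mxle 0 X /\ X *m const_mx 1 = const_mx 1 :> 'cV[R]_n.

Definition accessible X (i j : 'I_n) : Prop :=
  exists k : nat, 0 < (X ^+ k) i j.

Definition irreducible_mx X : Prop := forall i j, accessible X i j.

Definition stationary_mx X v : Prop :=
  [/\ mxle 0 v, v *m const_mx 1 = 1%:M & v *m X = v].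

Definition closed_comm_class X C : Prop :=
  [/\ C != finset.set0,
      forall i j, i \in C -> j \in C -> accessible X i j &
      forall i j, i \in C -> accessible X i j -> j \in C].

(* d is the greatest common divisor of the return times of i. *)
Definition is_period X (i : 'I_n) (d : nat) : Prop :=
  (forall k, (0 < k)%N -> 0 < (X ^+ k) i i -> (d %| k)%N) /\
  (forall d', (forall k, (0 < k)%N -> 0 < (X ^+ k) i i -> (d' %| k)%N) ->
     (d' %| d)%N).

Definition aperiodic_class X C : Prop := forall i, i \in C -> is_period X i 1.

End FiniteMatrix.

Section MatrixSeries.
Variables (R : realType) (m n : nat).
Implicit Type X : nat -> 'M[R]_(m, n).

(* The topology on 'M[R]_(m, n) is that of entrywise convergence, so this is the
   entrywise sum of the X k for k >= l; it is meaningful when mx_summable l X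
   holds, which for nonnegative X says that every entry of the sum is finite. *)
Definition mx_sum (l : nat) X : 'M[R]_(m, n) :=
  limn (fun N => \sum_(l <= k < N) X k).

Definition mx_summable (l : nat) X : Prop :=
  cvgn (fun N => \sum_(l <= k < N) X k).

Definition tail X (k : nat) : 'M[R]_(m, n) := mx_sum k.+1 X.

Definition radius X : \bar R :=
  ereal_sup [set z%:E | z in
    [set z : R | 1 <= z /\ mx_summable 1 (fun k => z ^+ k *: X k)]].

End MatrixSeries.

(* The blocks A_k and B_k, k >= -1; blkA k is A_k for k >= 0, and blkB k is B_k
   for k >= 1 (blkB 0 is never used: B_0 has another shape and is blkB0). *)
Record mg1_blocks (R : realType) (M0 M1 : nat) := Mg1Blocks {
  blkAm1 : 'M[R]_M1;
  blkA   : nat -> 'M[R]_M1;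
  blkBm1 : 'M[R]_(M1, M0);
  blkB0  : 'M[R]_M0;
  blkB   : nat -> 'M[R]_(M0, M1)
}.

Definition level_size (M0 M1 k : nat) : nat := if k is 0 then M0 else M1.

Definition mg1_state (M0 M1 : nat) : choiceType :=
  {k : nat & 'I_(level_size M0 M1 k)}.

Section MG1.
Variables (R : realType) (M0 M1 : nat).
Implicit Types (Q : mg1_blocks R M0 M1) (p : mg1_state M0 M1 -> R).

Definition mg1_block Q (k l : nat)
  : 'M[R]_(level_size M0 M1 k, level_size M0 M1 l) :=
  match k, l with
  | 0, 0 => blkB0 Q
  | 0, l'.+1 => blkB Q l'.+1
  | 1, 0 => blkBm1 Q
  | _.+2, 0 => 0
  | k'.+1, l'.+1 =>
      if (k' <= l')%N then blkA Q (l' - k')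
      else if k' == l'.+1 then blkAm1 Q else 0
  end.

Definition mg1_matrix Q (s t : mg1_state M0 M1) : R :=
  mg1_block Q (tag s) (tag t) (tagged s) (tagged t).

Definition level p (k : nat) : 'rV[R]_(level_size M0 M1 k) :=
  \row_i p (existT _ k i).

Definition level0 p : 'rV[R]_M0 := level p 0.

Definition tail0 p : 'rV[R]_M1 :=
  mx_sum 0 (fun l => level p l.+1 : 'rV[R]_M1).

Definition sumA Q : 'M[R]_M1 := blkAm1 Q + mx_sum 0 (blkA Q).

(* The series converges as soon as rA Q > 1. *)
Definition meanA Q : 'cV[R]_M1 :=
  - (blkAm1 Q *m const_mx 1)
  + mx_sum 1 (fun k => k%:R *: (blkA Q k *m const_mx 1)).

Definition meanB_finite Q : Prop :=
  mx_summable 1 (fun k => k%:R *: (blkB Q k *m const_mx 1) : 'cV[R]_M0).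

Definition drift Q (varpi : 'rV[R]_M1) : R := (varpi *m meanA Q) 0 0.

Definition G_solution Q (G : 'M[R]_M1) : Prop :=
  mxle 0 G /\
  (fun n => blkAm1 Q + \sum_(0 <= m < n) blkA Q m *m G ^+ m.+1) @ \oo --> G.

Definition G_minimal Q (G : 'M[R]_M1) : Prop :=
  G_solution Q G /\ forall H, G_solution Q H -> mxle G H.

Definition rA Q : \bar R := radius (blkA Q).
Definition rB Q : \bar R := radius (blkB Q).

(* Only used for N >= 1, so that A_{-1}, B_{-1} and B_0 are kept. *)
Definition LI_blocks Q (N : nat) : mg1_blocks R M0 M1 :=
  let trunc (m n : nat) (X : nat -> 'M[R]_(m, n)) (k : nat) :=
    if (k < N)%N then X k else if k == N then tail X N.-1 else 0 in
  Mg1Blocks (blkAm1 Q) (trunc _ _ (blkA Q)) (blkBm1 Q) (blkB0 Q)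
            (trunc _ _ (blkB Q)).

End MG1.

(* Main.v *)
Require Import Defs.
From HB Require Import structures.
From mathcomp Require Import all_boot all_order all_algebra.
From mathcomp Require Import all_classical all_reals all_analysis.
From mathcomp Require Import ring lra zify.

Import Order.TTheory GRing.Theory Num.Theory.
Import numFieldNormedType.Exports.

Local Open Scope classical_set_scope.
Local Open Scope ring_scope.

(** Let [h] solve the Poisson equation [P h = h + p s0 - 1_{s0}] of the chain.
    A truncated chain [P^(N)] has a stationary law [pN], and integrating
    [P^(N) h - h] against it gives zero, so that

      [pN s0 - p s0 = - pN (P h - P^(N) h)].

    From level [k] the truncation replaces the jumps of size [l > N] by jumps of
    size [N]; hence [P h - P^(N) h] involves only increments of [h] from level
    [k + N] to level [k + l]. If the increment of [h] per level tends to a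
    constant [kap], the difference is asymptotically [kap] times the sum of
    [(l - N) * blkA Q l] over [l > N], applied to the vector of ones. This is the
    double tail at [N - 1], and its quotient by [r ^- N * f N] tends to [r * cA];
    at level 0 the blocks [blkB Q l] and [cB] take over. Uniformity over all [k]
    is automatic, and since [pN] converges to [p] the formula follows with
    [kap = p s0 / sigma], where [sigma < 0] is the drift.

    The Poisson equation. Let [a] satisfy [A a + meanA = a + sigma e]
    ([drift_corrector]), so that [k + a i] has the constant drift [sigma] off the
    boundary. Above a level [J] a solution is sought in the form
    [h(J + m) = G^m z + kap (m e + a)]: powers of [G] are harmonic for the level
    process ([G_harmonic]). Then the equation holds automatically above level
    [J], and there remain finitely many linear equations, one fewer than the
    unknowns, namely the values of [h] up to level [J] and the constant in the
    equation ([extend], [residual_linear]). The kernel consists of the constants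
    ([residual_kernel]): integration against [p] makes the additive constant
    vanish, and bounded harmonic functions of an irreducible chain with a
    stationary law are constant ([bounded_harmonic_cst]). So the system can be
    solved ([poisson_solution]), and the increments of [h] are
    [kap e + (G^(m+1) z - G^m z)].

    These increments tend to [kap e] because [G] is stochastic and a power of it
    has a column bounded below by a positive number. Stochasticity follows from
    negative drift by a maximum principle ([G_stochastic]); the positive column
    from the aperiodicity of the class, which by irreducibility of [A] is reached
    from every phase ([G_reaches_class], [aperiodic_doeblin],
    [doeblin_increment_cvg0]).

    Integrability. All integrations need [p] and [pN] to have finite mean level,
    with a bound uniform in [N] to pass to the limit in the phase marginals
    ([tail0_cvg_tight]). The Lyapunov function [k^2 + 2 k (a i)], which is finite
    under [P] because [r > 1] gives second moments to the jumps, provides it for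
    [P] and, being increasing in the level, for all [P^(N)] at once
    ([uniform_mean_level]). *)

Set Implicit Arguments.
Unset Strict Implicit.

(** * Real series and entrywise convergence of matrices *)

Section RealSeries.
Context {R : realType}.
Implicit Types (x y : nat -> R) (l n : nat).

Lemma cvg_mxP (m q : nat) (F : nat -> 'M[R]_(m, q)) (M : 'M[R]_(m, q)) :
  F @ \oo --> M <-> forall i j, F k i j @[k --> \oo] --> M i j.
Proof.
split=> [FM i j | FM].
  apply: (@cvg_comp _ _ _ F (fun X : 'M[R]_(m, q) => X i j)); first exact: FM.
  exact: coord_continuous.
move=> A [P MP PA].
have : \forall k \near \oo, forall i j, P i j (F k i j).
  apply: filter_forall => i; apply: filter_forall => j.
  exact: (FM i j).
by apply: filterS => k Pk; apply: PA => i j; apply: Pk.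
Qed.

Lemma sum_mxE (m q : nat) (X : nat -> 'M[R]_(m, q)) l n i j :
  (\sum_(l <= k < n) X k) i j = \sum_(l <= k < n) X k i j.
Proof. by rewrite summxE. Qed.

Lemma mx_summableP (m q : nat) l (X : nat -> 'M[R]_(m, q)) :
  mx_summable l X <-> forall i j, cvgn (fun n => \sum_(l <= k < n) X k i j).
Proof.
split=> [/cvg_ex[M /cvg_mxP XM] i j | Xc].
  apply/cvg_ex; exists (M i j); have := XM i j.
  by under eq_fun do rewrite sum_mxE.
apply/cvg_ex; exists (\matrix_(i, j) limn (fun n => \sum_(l <= k < n) X k i j)).
apply/cvg_mxP => i j; rewrite mxE.
by under eq_fun do rewrite sum_mxE; exact: Xc.
Qed.

Lemma cvg_mx_sum (m q : nat) l (X : nat -> 'M[R]_(m, q)) : mx_summable l X ->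
  forall i j, \sum_(l <= k < n) X k i j @[n --> \oo] --> mx_sum l X i j.
Proof.
move=> Xs i j; have /cvg_mxP/(_ i j) := Xs.
by under eq_fun do rewrite sum_mxE.
Qed.

Lemma cvg_seqD x y (a b : R) : x @ \oo --> a -> y @ \oo --> b ->
  x n + y n @[n --> \oo] --> a + b.
Proof. by move=> xa yb; apply: cvgD. Qed.

Lemma cvg_seqB x y (a b : R) : x @ \oo --> a -> y @ \oo --> b ->
  x n - y n @[n --> \oo] --> a - b.
Proof. by move=> xa yb; apply: cvgB. Qed.

Lemma cvg_seqZ (c : R) x (a : R) : x @ \oo --> a ->
  c * x n @[n --> \oo] --> c * a.
Proof. by move=> xa; apply: cvgM => //; exact: cvg_cst. Qed.

Lemma cvg_finsum (I : finType) (F : I -> nat -> R) (a : I -> R) :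
  (forall i, F i n @[n --> \oo] --> a i) ->
  \sum_i F i n @[n --> \oo] --> \sum_i a i.
Proof. by move=> Fa; apply: cvg_big => //; exact: add_continuous. Qed.

Lemma cvg_mulmxl (m q w : nat) (F : nat -> 'M[R]_(m, q)) (M : 'M[R]_(m, q))
    (V : 'M[R]_(q, w)) :
  F @ \oo --> M -> F n *m V @[n --> \oo] --> M *m V.
Proof.
move=> /cvg_mxP FM; apply/cvg_mxP => i j; rewrite mxE.
under eq_fun do rewrite mxE.
by apply: cvg_finsum => l; apply: cvgM; [exact: FM | exact: cvg_cst].
Qed.

Lemma sum_from l n x : (l <= n)%N ->
  \sum_(l <= k < n) x k = \sum_(0 <= k < n) x k - \sum_(0 <= k < l) x k.
Proof.
move=> ln; rewrite (@big_cat_nat _ _ _ l 0 n) //=.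
by rewrite addrAC subrr add0r.
Qed.

Lemma cvg_sum_from l x (s : R) :
  \sum_(0 <= k < n) x k @[n --> \oo] --> s ->
  \sum_(l <= k < n) x k @[n --> \oo] --> s - \sum_(0 <= k < l) x k.
Proof.
move=> xs; have : (\sum_(0 <= k < n) x k - \sum_(0 <= k < l) x k)
    @[n --> \oo] --> s - \sum_(0 <= k < l) x k.
  by apply: cvgB => //; exact: cvg_cst.
apply: cvg_trans; apply: near_eq_cvg; near=> n.
by rewrite (@sum_from l n) //; near: n; exact: nbhs_infty_ge.
Unshelve. all: by end_near. Qed.

Lemma is_cvg_sum_from l x : cvgn (fun n => \sum_(0 <= k < n) x k) ->
  cvgn (fun n => \sum_(l <= k < n) x k).
Proof. by move=> /cvg_ex[s xs]; apply: cvgP; apply: cvg_sum_from; exact: xs. Qed.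

Lemma nonneg_sum_nondecr l x : (forall k, 0 <= x k) ->
  nondecreasing_seq (fun n => \sum_(l <= k < n) x k).
Proof. by move=> x0; apply: nondecreasing_series => k _ _; exact: x0. Qed.

Lemma nonneg_sum_cvg l x (M : R) : (forall k, 0 <= x k) ->
  (forall n, \sum_(l <= k < n) x k <= M) ->
  cvgn (fun n => \sum_(l <= k < n) x k).
Proof.
move=> x0 xM; apply: nondecreasing_is_cvgn; first exact: nonneg_sum_nondecr.
by exists M => _ [n _ <-]; exact: xM.
Qed.

Lemma nonneg_sum_le l x (s : R) n : (forall k, 0 <= x k) ->
  \sum_(l <= k < n) x k @[n --> \oo] --> s -> \sum_(l <= k < n) x k <= s.
Proof.
move=> x0 xs; rewrite -(cvg_lim _ xs) //.
by apply: nondecreasing_cvgn_le; [exact: nonneg_sum_nondecr | exact: cvgP xs].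
Qed.

Lemma cvg_le_bound (u : nat -> R) (s M : R) :
  u @ \oo --> s -> (\forall n \near \oo, u n <= M) -> s <= M.
Proof. by move=> us uM; apply: (cvgr_to_le us). Qed.

Lemma dom_sum_cvg x y : (forall k, `|x k| <= y k) ->
  cvgn (fun n => \sum_(0 <= k < n) y k) ->
  cvgn (fun n => \sum_(0 <= k < n) x k).
Proof.
move=> xy yc; apply: normed_cvg; apply: series_le_cvg yc => //=.
by move=> n; apply: le_trans (xy n).
Qed.

Lemma sum_tail_cvg0 x (t : nat -> R) :
  (forall l, \sum_(l <= k < n) x k @[n --> \oo] --> t l) -> t @ \oo --> 0.
Proof.
move=> xt; have t0 := xt 0%N.
have -> : t = fun l => t 0%N - \sum_(0 <= k < l) x k.
  apply/funext => l; apply: (cvg_unique _ (xt l)) => //.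
  exact: cvg_sum_from.
suff : (t 0%N - \sum_(0 <= k < l) x k) @[l --> \oo] --> t 0%N - t 0%N.
  by rewrite subrr.
by apply: cvgB; [exact: cvg_cst | exact: t0].
Qed.

(** Each [x l] with [l > m] is counted once by each of the tails
    [t m, ..., t l.-1]; cutting the outer sum at [n] leaves an error
    [(n - m) * t n.-1], which the remainder of the weighted series dominates. *)
Lemma double_tail_cvg x (t : nat -> R) m : (forall k, 0 <= x k) ->
  (forall k, \sum_(k.+1 <= l < n) x l @[n --> \oo] --> t k) ->
  forall T : R,
  \sum_(m <= l < n) (l - m)%:R * x l @[n --> \oo] --> T ->
  \sum_(m <= k < n) t k @[n --> \oo] --> T.
Proof.
move=> x0 xt T yT; pose y l := (l - m)%:R * x l.
have y0 k : 0 <= y k by rewrite mulr_ge0.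
have tS k : t k = x k.+1 + t k.+1.
  apply: (cvg_unique _ (xt k)) => //.
  have : (x k.+1 + \sum_(k.+2 <= l < n) x l) @[n --> \oo] --> x k.+1 + t k.+1.
    by apply: cvgD; [exact: cvg_cst | exact: xt].
  apply: cvg_trans; apply: near_eq_cvg; near=> n.
  by rewrite [RHS]big_ltn //; near: n; exact: nbhs_infty_ge.
have E n : (m <= n)%N ->
    \sum_(m <= k < n.+1) t k =
    \sum_(m <= l < n.+1) y l + (n.+1 - m)%:R * t n.
  elim: n => [|n IH] mn.
    move: mn; rewrite leqn0 => /eqP m0; rewrite /y m0 !big_nat1 subnn mul0r.
    by rewrite add0r subn0 mul1r.
  case: (leqP m n) => [mn'|nm]; last first.
    have mE : m = n.+1 by apply/eqP; rewrite eqn_leq mn.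
    by rewrite /y mE !big_nat1 subnn mul0r add0r subSnn mul1r.
  rewrite big_nat_recr //= IH // [in RHS]big_nat_recr //= /y tS (subSn mn).
  rewrite -(natr1 (n.+1 - m)).
  ring.
have R0 : (n.+1 - m)%:R * t n @[n --> \oo] --> (0 : R).
  have yT0 : (T - \sum_(m <= l < n.+1) y l) @[n --> \oo] --> (0 : R).
    suff : (T - \sum_(m <= l < n.+1) y l) @[n --> \oo] --> T - T.
      by rewrite subrr.
    apply: cvgB; first exact: cvg_cst.
    by have := yT; rewrite -cvg_shiftS.
  apply: (squeeze_cvgr _ (cvg_cst 0) yT0).
    near=> n.
    have mn : (m <= n)%N by near: n; exact: nbhs_infty_ge.
    have tn0 : 0 <= t n.
      by apply: (le_trans _ (nonneg_sum_le n.+1 x0 (xt n))); rewrite big_geq.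
    rewrite mulr_ge0 //=.
    have yn : \sum_(n.+1 <= l < q) y l @[q --> \oo] --> T - \sum_(m <= l < n.+1) y l.
      have : (\sum_(m <= l < q) y l - \sum_(m <= l < n.+1) y l) @[q --> \oo]
         --> T - \sum_(m <= l < n.+1) y l.
        by apply: cvgB => //; exact: cvg_cst.
      apply: cvg_trans; apply: near_eq_cvg; near=> q.
      rewrite (@big_cat_nat _ _ _ n.+1 m q) //=; last 2 first.
      - by rewrite leqW.
      - by near: q; exact: nbhs_infty_ge.
      by rewrite addrAC subrr add0r.
    have xn : (n.+1 - m)%:R * \sum_(n.+1 <= l < q) x l @[q --> \oo]
        --> (n.+1 - m)%:R * t n by apply: cvgM; [exact: cvg_cst | exact: xt].
    apply: ler_cvg_to xn yn _; near=> q.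
    rewrite mulr_sumr !big_nat; apply: ler_sum => l /andP[nl _].
    by rewrite ler_wpM2r // ler_nat leq_sub2r.
rewrite -(cvg_shiftS (fun n => \sum_(m <= k < n) t k)).
have : (\sum_(m <= l < n.+1) y l + (n.+1 - m)%:R * t n) @[n --> \oo] --> T + 0.
  apply: cvgD => //; by have := yT; rewrite -cvg_shiftS.
rewrite addr0; apply: cvg_trans; apply: near_eq_cvg; near=> n.
by rewrite /= E //; near: n; exact: nbhs_infty_ge.
Unshelve. all: by end_near. Qed.
End RealSeries.

(** * Sums over the states, level by level *)

Section LevelSums.
Context {R : realType} {M0 M1 : nat}.
Local Notation S := (mg1_state M0 M1).
Local Notation st k i := (existT (fun l => 'I_(level_size M0 M1 l)) k i : S).
Implicit Types (a b f g : S -> R) (s t : S) (n k : nat).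

(** For nonnegative summands the limit of these partial sums is the unordered
    sum over the states; for a row of an M/G/1-type matrix they are the partial
    sums of a series of matrix products. *)
Definition psum a n : R :=
  \sum_(0 <= k < n) \sum_(i < level_size M0 M1 k) a (st k i).

Lemma eq_psum a b n : a =1 b -> psum a n = psum b n.
Proof. by move=> ab; apply: eq_bigr => k _; apply: eq_bigr. Qed.

Lemma psumD a b n : psum (fun s => a s + b s) n = psum a n + psum b n.
Proof. by rewrite -big_split; apply: eq_bigr => k _; rewrite big_split. Qed.

Lemma psumZ (c : R) a n : psum (fun s => c * a s) n = c * psum a n.
Proof. by rewrite mulr_sumr; apply: eq_bigr => k _; rewrite mulr_sumr. Qed.

Lemma psumN a n : psum (fun s => - a s) n = - psum a n.
Proof.
by rewrite -mulN1r -psumZ; apply: eq_psum => s; rewrite mulN1r.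
Qed.

Lemma psumB a b n : psum (fun s => a s - b s) n = psum a n - psum b n.
Proof. by rewrite psumD psumN. Qed.

Lemma le_psum_lt a b n : (forall s, (tag s < n)%N -> a s <= b s) ->
  psum a n <= psum b n.
Proof.
move=> ab; rewrite /psum !big_nat; apply: ler_sum => k /= kn.
by apply: ler_sum => i _; exact: ab.
Qed.

Lemma le_psum a b n : (forall s, a s <= b s) -> psum a n <= psum b n.
Proof. by move=> ab; apply: le_psum_lt. Qed.

Lemma psum_ge0 a n : (forall s, 0 <= a s) -> 0 <= psum a n.
Proof. by move=> a0; do 2![apply: sumr_ge0 => ? _]. Qed.

Lemma ler_norm_psum a n : `|psum a n| <= psum (fun s => `|a s|) n.
Proof.
apply: le_trans (ler_norm_sum _ _ _) _.
by apply: ler_sum => k _; exact: ler_norm_sum.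
Qed.

Lemma psum_nondecr a : (forall s, 0 <= a s) -> nondecreasing_seq (psum a).
Proof. by move=> a0; apply: nonneg_sum_nondecr => k; exact: sumr_ge0. Qed.

Lemma psum_le_lim a (x : R) n : (forall s, 0 <= a s) ->
  psum a @ \oo --> x -> psum a n <= x.
Proof. by move=> a0 ax; apply: nonneg_sum_le ax => k; exact: sumr_ge0. Qed.

Lemma psum_term_le a s n : (forall s, 0 <= a s) -> (tag s < n)%N ->
  a s <= psum a n.
Proof.
case: s => k i /= a0 kn; rewrite /psum (bigD1_seq k) ?iota_uniq //=; last first.
  by rewrite mem_index_iota.
rewrite (bigD1 i) //= -addrA lerDl; apply: addr_ge0; apply: sumr_ge0 => // j _.
exact: sumr_ge0.
Qed.

Lemma psum_pred1 a s0 n : (tag s0 < n)%N ->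
  psum (fun s => a s * (s == s0)%:R) n = a s0.
Proof.
case: s0 => k0 i0 /= n0.
rewrite /psum (bigD1_seq k0) ?iota_uniq //=; last by rewrite mem_index_iota.
rewrite (bigD1 i0) //= eqxx mulr1 !big1 ?addr0 //.
  move=> k kk0; apply: big1 => i _; case: eqP => [/(congr1 tag) /= kE|_].
    by rewrite kE eqxx in kk0.
  by rewrite mulr0.
move=> i ii0; case: eqP => [/eqP|_]; last by rewrite mulr0.
by rewrite -tag_eqE /tag_eq /= eqxx /= tagged_asE (negbTE ii0).
Qed.

Lemma term_le_lim a (x : R) s : (forall s, 0 <= a s) ->
  psum a @ \oo --> x -> a s <= x.
Proof.
move=> a0 ax; apply: le_trans (psum_le_lim (tag s).+1 a0 ax).
exact: psum_term_le.
Qed.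

Lemma psum_bounded_cvg a (M : R) : (forall s, 0 <= a s) ->
  (forall n, psum a n <= M) -> cvgn (psum a).
Proof. by move=> a0 aM; apply: nonneg_sum_cvg aM => k; exact: sumr_ge0. Qed.

Lemma psum_dom_cvg a b : (forall s, `|a s| <= b s) -> cvgn (psum b) ->
  cvgn (psum a).
Proof.
move=> ab; apply: dom_sum_cvg => k; apply: le_trans (ler_norm_sum _ _ _) _.
by apply: ler_sum => i _.
Qed.

Lemma esum_levels a : (forall s, 0 <= a s) ->
  \esum_(s in [set: S]) (a s)%:E = limn (fun n => (psum a n)%:E).
Proof.
move=> a0.
have -> : [set: S] = \bigcup_k [set s : S | tag s = k].
  by apply/seteqP; split=> // s _; exists (tag s).
rewrite nneseries_sum_bigcup; first last.
- by move=> s; rewrite lee_fin.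
- by move=> i j _ _ [s [/= <- <-]].
apply: (congr1 (fun u : nat -> \bar R => limn u)); apply/funext => n.
rewrite -sumEFin; apply: eq_bigr => k _; rewrite -sumEFin.
rewrite (reindex_esum [set: 'I_(level_size M0 M1 k)] _ (fun i => st k i)).
  rewrite -[RHS]big_enum /= fsbig_seq ?enum_uniq //.
  have -> : [set` enum 'I_(level_size M0 M1 k)] = setT.
    by apply/seteqP; split=> // i _ /=; rewrite mem_enum.
  by rewrite (esum_fset finite_finset) // => i _; rewrite lee_fin.
split=> [i|i j _ _ /eqP|[k' i] /= k'k] //=.
  by rewrite -tag_eqE /tag_eq /= eqxx /= tagged_asE => /eqP.
by subst k'; exists i.
Qed.

Lemma cvg_psum_esum a (x : R) : (forall s, 0 <= a s) -> psum a @ \oo --> x ->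
  \esum_(s in [set: S]) (a s)%:E = x%:E.
Proof.
move=> a0 ax; rewrite esum_levels // (@EFin_lim R (psum a)); last exact: cvgP ax.
by congr EFin; apply/cvg_lim.
Qed.

Lemma esum_cvg_psum a (x : R) : (forall s, 0 <= a s) ->
  \esum_(s in [set: S]) (a s)%:E = x%:E -> psum a @ \oo --> x.
Proof.
move=> a0 ax.
have ac : cvgn (psum a).
  apply: (@psum_bounded_cvg _ x) => // n; rewrite -lee_fin -ax esum_levels //.
  apply: lime_ge; last first.
    near=> m; rewrite lee_fin; apply: psum_nondecr => //.
    by near: m; exact: nbhs_infty_ge.
  apply: ereal_nondecreasing_is_cvgn => i j ij; rewrite lee_fin.
  exact: psum_nondecr.
have := cvg_psum_esum a0 ac; rewrite ax => -[->]; exact: ac.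
Unshelve. all: by end_near. Qed.

Lemma esum_exchange (u : S -> S -> \bar R) : (forall s t, 0 <= u s t)%E ->
  \esum_(s in [set: S]) \esum_(t in [set: S]) u s t =
  \esum_(t in [set: S]) \esum_(s in [set: S]) u s t.
Proof.
move=> u0; rewrite !esum_esum //.
rewrite (reindex_esum ([set: S] `*`` (fun=> [set: S])) _ (fun x => (x.2, x.1))) //.
split=> //.
  by move=> [i1 i2] [j1 j2] /= _ _ [] -> ->.
by move=> [i1 i2] _ /=; exists (i2, i1).
Qed.

End LevelSums.

(** * Countable chains and their stationary laws *)

Section Chain.
Context {R : realType} {M0 M1 : nat}.
Local Notation S := (mg1_state M0 M1).
Implicit Types (f g h q : S -> R) (s t : S) (n : nat).
Variables (P : S -> S -> R) (p : S -> R).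
Hypothesis hP : stochastic P.

Let P0 s t : 0 <= P s t. Proof. by case: hP. Qed.

Lemma row_sum1 s : psum (P s) @ \oo --> (1 : R).
Proof. by case: hP => _ /(_ s); apply: esum_cvg_psum. Qed.

Lemma cst_row_cvg (c : R) s : psum (fun t => P s t * c) @ \oo --> c.
Proof.
have : c * psum (P s) n @[n --> \oo] --> c * 1.
  by apply: cvgM; [exact: cvg_cst | exact: row_sum1].
rewrite mulr1; apply: cvg_trans; apply: near_eq_cvg; near=> n.
by rewrite -psumZ; apply: eq_psum => t; rewrite mulrC.
Unshelve. all: by end_near. Qed.

Arguments cst_row_cvg : clear implicits.

Lemma bounded_row_cvg f (c : R) s : (forall t, `|f t| <= c) ->
  cvgn (psum (fun t => P s t * f t)).
Proof.
move=> fc; apply: (@psum_dom_cvg _ _ _ _ (fun t => P s t * c)) => [t|].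
  by rewrite normrM (ger0_norm (P0 _ _)) ler_wpM2l.
exact: cvgP _ (cst_row_cvg c s).
Qed.

Lemma irreducible_closed (X : S -> Prop) s : irreducible P ->
  (forall u v, X u -> 0 < P u v -> X v) -> X s -> forall t, X t.
Proof.
move=> irr Xcl Xs t; have [n] := irr s t; elim: n s Xs => [|n IH] s Xs /=.
  by case: eqP => [<-//|_]; rewrite ltxx.
move=> pos; apply: contrapT => nXt; move: pos; apply/negP; rewrite -leNgt.
rewrite -(esum1 (D := [set: S]) (a := fun=> 0%E)) //; apply: le_esum => u _.
have [Psu|] := ltP 0 (P s u); last first.
  move=> Psu; have -> : P s u = 0 by apply/le_anti; rewrite Psu P0.
  by rewrite mul0e.
apply: mule_ge0_le0; first by rewrite lee_fin.
by rewrite leNgt; apply/negP => /(IH u (Xcl _ _ Xs Psu)).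
Qed.

Hypothesis hp : stationary P p.
Let p0 s : 0 <= p s. Proof. by case: hp. Qed.

Lemma law_sum1 : psum p @ \oo --> (1 : R).
Proof. by case: hp => _ + _; apply: esum_cvg_psum. Qed.

Lemma law_le1 s : p s <= 1.
Proof. by apply: term_le_lim law_sum1. Qed.

Lemma law_cst (c : R) : psum (fun s => p s * c) @ \oo --> c.
Proof.
have : c * psum p n @[n --> \oo] --> c * 1.
  by apply: cvgM; [exact: cvg_cst | exact: law_sum1].
rewrite mulr1; apply: cvg_trans; apply: near_eq_cvg; near=> n.
by rewrite -psumZ; apply: eq_psum => t; rewrite mulrC.
Unshelve. all: by end_near. Qed.

Arguments law_cst : clear implicits.

Lemma bounded_law_cvg f (c : R) : (forall t, `|f t| <= c) ->
  cvgn (psum (fun t => p t * f t)).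
Proof.
move=> fc; apply: (@psum_dom_cvg _ _ _ _ (fun t => p t * c)) => [t|].
  by rewrite normrM (ger0_norm (p0 _)) ler_wpM2l.
exact: cvgP _ (law_cst c).
Qed.

(** Tonelli's theorem allows summing over the starting state first. *)
Lemma stationary_nonneg g (Pg : S -> R) (x : R) : (forall s, 0 <= g s) ->
  (forall s, psum (fun t => P s t * g t) @ \oo --> Pg s) ->
  psum (fun s => p s * g s) @ \oo --> x ->
  psum (fun s => p s * Pg s) @ \oo --> x.
Proof.
move=> g0 gPg gx.
have Pg0 s : 0 <= Pg s.
  by apply: le_trans (psum_le_lim 0 _ (gPg s)) => [|t];
    rewrite ?/psum ?big_geq ?mulr_ge0.
have pg0 s : 0 <= p s * g s by rewrite mulr_ge0.
apply: esum_cvg_psum => [s|]; first by rewrite mulr_ge0.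
rewrite -(cvg_psum_esum pg0 gx).
transitivity (\esum_(s in [set: S]) \esum_(t in [set: S])
    (p s * (P s t * g t))%:E).
  apply: eq_esum => s _; apply/esym/cvg_psum_esum.
    by move=> t; rewrite !mulr_ge0.
  have : p s * psum (fun t => P s t * g t) n @[n --> \oo] --> p s * Pg s.
    by apply: cvgM; [exact: cvg_cst | exact: gPg].
  by under eq_fun do rewrite -psumZ.
rewrite esum_exchange; last by move=> s t; rewrite lee_fin !mulr_ge0.
apply: eq_esum => t _; apply: cvg_psum_esum.
  by move=> s; rewrite !mulr_ge0.
case: hp => _ _ /(_ t) /esum_cvg_psum pt.
have : g t * psum (fun s => p s * P s t) n @[n --> \oo] --> g t * p t.
  by apply: cvgM; [exact: cvg_cst | apply: pt => s; rewrite mulr_ge0].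
rewrite [g t * p t]mulrC; under eq_fun do rewrite -psumZ.
apply: cvg_trans; apply: near_eq_cvg; near=> n; apply: eq_psum => s.
by rewrite mulrC mulrA.
Unshelve. all: by end_near. Qed.

(** A stationary law integrates [P h - h] to zero, provided [h] is dominated by
    an integrable [g]: apply the nonnegative case to [h + g] and to [g]. *)
Lemma stationary_increment h q g (Pg : S -> R) (x : R) :
  (forall s, `|h s| <= g s) ->
  (forall s, psum (fun t => P s t * g t) @ \oo --> Pg s) ->
  psum (fun s => p s * g s) @ \oo --> x ->
  (forall s, psum (fun t => P s t * h t) @ \oo --> h s + q s) ->
  psum (fun s => p s * q s) @ \oo --> (0 : R).
Proof.
move=> hg gPg gx hq.
have g0 s : 0 <= g s by apply: le_trans (hg s).
have /cvg_ex[y hy] : cvgn (psum (fun s => p s * h s)).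
  apply: (@psum_dom_cvg _ _ _ _ (fun s => p s * g s)) => [s|].
    by rewrite normrM (ger0_norm (p0 _)) ler_wpM2l.
  exact: cvgP _ gx.
have hgPhg : psum (fun s => p s * (h s + q s + Pg s)) @ \oo --> y + x.
  apply: (@stationary_nonneg (fun s => h s + g s)).
  - by move=> s; have := hg s; rewrite ler_norml => /andP[]; lra.
  - move=> s; have : (psum (fun t => P s t * h t) n
        + psum (fun t => P s t * g t) n) @[n --> \oo] --> h s + q s + Pg s.
      by apply: cvgD.
    under eq_fun do rewrite -psumD.
    apply: cvg_trans; apply: near_eq_cvg; near=> n; apply: eq_psum => t.
    by rewrite mulrDr.
  - have : (psum (fun t => p t * h t) n
        + psum (fun t => p t * g t) n) @[n --> \oo] --> y + x by apply: cvgD.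
    under eq_fun do rewrite -psumD.
    apply: cvg_trans; apply: near_eq_cvg; near=> n; apply: eq_psum => t.
    by rewrite mulrDr.
have gPg' := stationary_nonneg g0 gPg gx.
have : (psum (fun s => p s * (h s + q s + Pg s)) n
   - psum (fun s => p s * Pg s) n - psum (fun s => p s * h s) n) @[n --> \oo]
   --> y + x - x - y by apply: cvgB => //; apply: cvgB.
have -> : y + x - x - y = 0 by ring.
apply: cvg_trans; apply: near_eq_cvg; near=> n; rewrite -!psumB.
by apply: eq_psum => s; ring.
Unshelve. all: by end_near. Qed.

(** [V] need not be integrable a priori: the drift condition is integrated for
    the truncations [Num.min V m] and [m] is then sent to infinity. *)
Lemma drift_bound (V g : S -> R) (b : R) : 0 <= b ->
  (forall s, 0 <= V s) -> (forall s, 0 <= g s) ->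
  (forall s n, psum (fun t => P s t * V t) n + g s <= V s + b) ->
  forall n, psum (fun s => p s * g s) n <= b.
Proof.
move=> b0 V0 g0 drift n.
pose Vm (m : R) s := Num.min (V s) m.
pose gm (m : R) s := if V s <= m then g s else 0.
have gm0 m s : 0 <= gm m s by rewrite /gm; case: ifP.
have key m : 0 <= m -> psum (fun s => p s * gm m s) n <= b.
  move=> m0.
  have Vm0 s : 0 <= Vm m s by rewrite /Vm le_min V0.
  have Vmm s : `|Vm m s| <= m by rewrite ger0_norm // /Vm ge_min lexx orbT.
  pose W s := limn (psum (fun t => P s t * Vm m t)).
  have VW s : psum (fun t => P s t * Vm m t) @ \oo --> W s.
    exact: bounded_row_cvg Vmm.
  have /cvg_ex[x Vx] := bounded_law_cvg Vmm.
  have Wx := stationary_nonneg Vm0 VW Vx.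
  have Wm s : W s <= m.
    apply: ler_cvg_to (VW s) (cst_row_cvg m s) _; near=> k.
    apply: le_psum => t; rewrite ler_wpM2l //.
    by have := Vmm t; rewrite ger0_norm.
  have Wd s : W s + gm m s <= Vm m s + b.
    rewrite /gm /Vm; case: (leP (V s) m) => Vs.
      suff : W s <= V s + b - g s by lra.
      apply: cvg_le_bound (VW s) _; near=> k.
      have : psum (fun t => P s t * Vm m t) k <= psum (fun t => P s t * V t) k.
        by apply: le_psum => t; rewrite ler_wpM2l // /Vm ge_min lexx.
      by have := drift s k; lra.
    by have := Wm s; lra.
  have lim : (psum (fun s => p s * Vm m s) k + psum (fun s => p s * b) k
      - psum (fun s => p s * W s) k) @[k --> \oo] --> x + b - x.
    apply: cvgB => //; apply: cvgD => //; exact: law_cst.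
  have -> : b = x + b - x by ring.
  apply: (cvgr_to_ge lim); near=> k.
  apply: (@le_trans _ _ (psum (fun s => p s * gm m s) k)).
    apply: psum_nondecr; first by move=> s; rewrite mulr_ge0.
    by near: k; exact: nbhs_infty_ge.
  rewrite -psumD -psumB; apply: le_psum => s.
  rewrite -mulrDr -mulrBr ler_wpM2l //; have := Wd s; lra.
(* below level [n] there are finitely many states, so one [m] dominates [V] *)
have [m m0 Vm'] : exists2 m, 0 <= m & forall s, (tag s < n)%N -> V s <= m.
  by exists (psum V n) => [|s sn]; [exact: psum_ge0 | exact: psum_term_le].
apply: le_trans (key m m0); apply: le_psum_lt => s sn.
by rewrite /gm Vm'.
Unshelve. all: by end_near. Qed.

Hypothesis irr : irreducible P.

Lemma stationary_gt0 s : 0 < p s.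
Proof.
have [s0 ps0] : exists s0, 0 < p s0.
  apply: contrapT => /forallNP np.
  have : psum p @ \oo --> (0 : R).
    have E : psum p = fun=> 0.
      apply/funext => n; rewrite (@eq_psum _ _ _ _ (fun=> 0)).
        by rewrite /psum big1 // => k _; rewrite big1.
      move=> t; apply/le_anti; rewrite p0 andbT leNgt.
      by apply/negP; exact: np.
    by rewrite E; exact: cvg_cst.
  move=> pz; have E : (1 : R) = 0 by apply: (cvg_unique _ law_sum1 pz).
  by have := oner_neq0 R; rewrite E eqxx.
apply: (@irreducible_closed (fun s => 0 < p s) s0 irr _ ps0) => u v pu Puv.
have pP w : 0 <= p w * P w v by rewrite mulr_ge0.
apply: lt_le_trans (term_le_lim u pP _); first by rewrite mulr_gt0.
by apply: esum_cvg_psum => //; case: hp.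
Qed.

Lemma stationary_zero q : (forall s, 0 <= q s) ->
  psum (fun s => p s * q s) @ \oo --> (0 : R) -> forall s, q s = 0.
Proof.
move=> q0 pq s; apply/le_anti; rewrite q0 andbT.
have pq0 t : 0 <= p t * q t by rewrite mulr_ge0.
by have := term_le_lim s pq0 pq; rewrite pmulr_rle0 // stationary_gt0.
Qed.

(** For every [s0] the positive part [g] of [h - h s0] is subharmonic, hence
    harmonic by stationarity, and vanishes at [s0], hence everywhere. *)
Lemma bounded_harmonic_cst h (c : R) : (forall s, `|h s| <= c) ->
  (forall s, psum (fun t => P s t * h t) @ \oo --> h s) ->
  forall s t, h s = h t.
Proof.
move=> hc hh.
have le s0 s : h s <= h s0.
  pose g t := Num.max (h t - h s0) 0.
  have g0 t : 0 <= g t by rewrite le_max lexx orbT.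
  have gc t : `|g t| <= 2 * c.
    rewrite ger0_norm // ge_max; have := hc t; have := hc s0.
    rewrite !ler_norml => /andP[h1 h2] /andP[h3 h4].
    by apply/andP; split; lra.
  have cP s1 : psum (fun t => P s1 t * (2 * c)) @ \oo --> 2 * c.
    exact: cst_row_cvg.
  pose Pg s := limn (psum (fun t => P s t * g t)).
  have gPg s1 : psum (fun t => P s1 t * g t) @ \oo --> Pg s1.
    exact: bounded_row_cvg gc.
  have Pg0 s1 : 0 <= Pg s1 - g s1.
    rewrite subr_ge0 ge_max; apply/andP; split; last first.
      by apply: (cvgr_to_ge (gPg s1)); near=> n; apply: psum_ge0 => t;
        rewrite mulr_ge0.
    have hs : (psum (fun t => P s1 t * h t) n
        - psum (fun t => P s1 t * h s0) n) @[n --> \oo] --> h s1 - h s0.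
      by apply: cvgB => //; exact: cst_row_cvg.
    apply: ler_cvg_to hs (gPg s1) _; near=> n; rewrite -psumB.
    apply: le_psum => t; rewrite -mulrBr ler_wpM2l // le_max lexx //.
  have /stationary_zero gz : psum (fun s => p s * (Pg s - g s)) @ \oo --> (0:R).
    apply: (stationary_increment (h := g) gc cP (law_cst _)) => s1.
    have -> : g s1 + (Pg s1 - g s1) = Pg s1 by ring.
    exact: gPg.
  have gs0 : g s0 = 0 by rewrite /g subrr; apply/max_idPl.
  have : g s = 0.
    apply: (@irreducible_closed (fun s => g s = 0) s0 irr _ gs0).
    move=> u v gu Puv; have Pgv t : 0 <= P u t * g t by rewrite mulr_ge0.
    apply/le_anti; rewrite g0 andbT -(pmulr_rle0 _ Puv).
    apply: le_trans (term_le_lim v Pgv (gPg u)) _.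
    by have := gz Pg0 u; rewrite gu; lra.
  by move=> gs; rewrite -subr_le0 -gs /g le_max lexx.
by move=> s t; apply/le_anti; rewrite !le.
Unshelve. all: by end_near. Qed.

End Chain.

(** * Finite chains: aperiodicity, contraction, solvability *)

Section NumericalSemigroup.

(** If [d] is the least positive difference of two elements of [X], division
    with remainder shows that [d] divides every element, so [d = 1] and [X]
    contains two consecutive integers. *)
Lemma additive_gcd1_cofinite (X : nat -> Prop) :
  X 0%N -> (forall m n, X m -> X n -> X (m + n)%N) ->
  (forall d, (forall k, (0 < k)%N -> X k -> (d %| k)%N) -> (d %| 1)%N) ->
  exists n0, forall n, (n0 <= n)%N -> X n.
Proof.
move=> X0 XD Xgcd.
have XM q n : X n -> X (q * n)%N.
  by move=> Xn; elim: q => [|q IH]; [rewrite mul0n | rewrite mulSn; exact: XD].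
pose D d := `[< (0 < d)%N /\ exists a b, [/\ X a, X b & a = (b + d)%N] >].
have exD : exists d, D d.
  apply: contrapT => nD; have := Xgcd 0%N; rewrite dvd0n => Xg.
  suff : false by []; apply: Xg => k k0 Xk; exfalso; apply: nD; exists k.
  by apply/asboolP; split=> //; exists k, 0%N.
case: (ex_minnP exD) => d /asboolP[d0 [a [b [Xa Xb ab]]]] dmin.
have d1 : d = 1%N.
  apply/eqP; rewrite -dvdn1; apply: Xgcd => s s0 Xs.
  rewrite /dvdn; apply/negPn/negP; rewrite -lt0n => r0.
  have /dmin : D (s %% d)%N.
    apply/asboolP; split=> //.
    exists (s + s %/ d * b)%N, (s %/ d * a)%N; split; [|exact: XM|].
      by apply: XD => //; exact: XM.
    by rewrite ab mulnDr {1}(divn_eq s d); lia.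
  by rewrite leqNgt ltn_mod d0.
rewrite d1 addn1 in ab; rewrite ab in Xa.
exists (b * b)%N => n bn; case: (posnP b) => b0.
  by rewrite -(muln1 n); apply: XM; move: Xa; rewrite b0.
have rq : (n %% b <= n %/ b)%N.
  apply: ltnW; apply: (leq_trans (n := b)); first by rewrite ltn_mod.
  by rewrite leq_divRL.
have -> : n = ((n %/ b - n %% b) * b + n %% b * b.+1)%N.
  rewrite mulnS addnCA -mulnDl subnK // addnC; exact: divn_eq.
by apply: XD; exact: XM.
Qed.

End NumericalSemigroup.

Section FiniteChains.
Context {R : realType} {n : nat}.
Implicit Types (K M : 'M[R]_n) (x y : 'cV[R]_n) (i j l : 'I_n).

Lemma stochastic_mxP K : stochastic_mx K <->
  (forall i j, 0 <= K i j) /\ (forall i, \sum_j K i j = 1).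
Proof.
split=> -[K0 K1].
  split=> [i j|i]; first by have := K0 i j; rewrite mxE.
  have /matrixP/(_ i ord0) := K1; rewrite !mxE => <-.
  by apply: eq_bigr => j _; rewrite mxE mulr1.
split; first by move=> i j; rewrite mxE.
apply/matrixP => i j; rewrite !mxE -[RHS](K1 i).
by apply: eq_bigr => l _; rewrite mxE mulr1.
Qed.

Lemma expmx_ge0 M : (forall i j, 0 <= M i j) -> forall k i j, 0 <= (M ^+ k) i j.
Proof.
move=> M0; elim=> [|k IH] i j; first by rewrite expr0 mxE ler0n.
by rewrite exprS mxE; apply: sumr_ge0 => l _; rewrite mulr_ge0.
Qed.

Lemma expmx_add_gt0 M a b i j l : (forall i j, 0 <= M i j) ->
  0 < (M ^+ a) i j -> 0 < (M ^+ b) j l -> 0 < (M ^+ (a + b)) i l.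
Proof.
move=> M0 ij jl; rewrite exprD mxE (bigD1 j) //=.
rewrite ltr_pwDl ?mulr_gt0 //; apply: sumr_ge0 => k _.
by rewrite mulr_ge0 ?expmx_ge0.
Qed.

Lemma expmx_stochastic K k : stochastic_mx K -> stochastic_mx (K ^+ k).
Proof.
case=> K0 K1; split=> [i j|].
  by rewrite mxE; apply: expmx_ge0 => {}i {}j; have := K0 i j; rewrite mxE.
elim: k => [|k IH]; first by rewrite expr0 mul1mx.
by rewrite exprS -mulmxA IH K1.
Qed.

Lemma accessible_closed M (X : 'I_n -> Prop) k i j : (forall i j, 0 <= M i j) ->
  (forall i j, X i -> 0 < M i j -> X j) -> 0 < (M ^+ k) i j -> X i -> X j.
Proof.
move=> M0 Xcl; elim: k i => [|k IH] i.
  by rewrite expr0 mxE; case: eqP => [->|_]; rewrite ?ltxx.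
move=> + Xi; rewrite exprS mxE => pos; apply: contrapT => nXj.
suff E : \sum_l M i l * (M ^+ k) l j = 0.
  by move: pos; rewrite E ltxx.
apply: big1 => l _; apply/eqP; rewrite mulf_eq0 -[_ || _]negbK negb_or.
rewrite !neq_lt !(ltNge _ 0) M0 expmx_ge0 //=; apply/negP => /andP[il lj].
by apply: nXj; apply: IH lj _; exact: Xcl il.
Qed.

Lemma irreducible_mx_closed M (X : 'I_n -> Prop) i : (forall i j, 0 <= M i j) ->
  irreducible_mx M -> (forall i j, X i -> 0 < M i j -> X j) -> X i ->
  forall j, X j.
Proof. by move=> M0 irr Xcl Xi j; have [k] := irr i j; move/accessible_closed; apply. Qed.

(** The states where [x] is maximal are closed under transitions. *)
Lemma harmonic_mx_cst K x : stochastic_mx K -> irreducible_mx K ->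
  K *m x = x -> forall i j, x i 0 = x j 0.
Proof.
move=> /stochastic_mxP[K0 K1] irr Kx i j.
pose m := [arg max_(l > i) x l 0]%O.
have mmax l : x l 0 <= x m 0.
  by rewrite /m; case: arg_maxP => // a _ amax; exact: amax.
suff E l : x l 0 = x m 0 by rewrite !E.
apply: (@irreducible_mx_closed K (fun l => x l 0 = x m 0) m) => // a b xa Kab.
have S0 : \sum_l K a l * (x m 0 - x l 0) = 0.
  under eq_bigr do rewrite mulrBr; rewrite sumrB -mulr_suml K1 mul1r.
  have /matrixP/(_ a 0) := Kx; rewrite mxE => ->.
  by rewrite xa subrr.
have : K a b * (x m 0 - x b 0) == 0.
  move/eqP: S0; rewrite psumr_eq0; last first.
    by move=> d _; rewrite mulr_ge0 // subr_ge0.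
  by move=> /allP/(_ b); rewrite mem_index_enum => /(_ isT).
by rewrite mulf_eq0 gt_eqF //= subr_eq0 => /eqP.
Qed.

Lemma stochastic_bounds K x (lo hi : R) : stochastic_mx K ->
  (forall i, lo <= x i 0 <= hi) -> forall i, lo <= (K *m x) i 0 <= hi.
Proof.
move=> /stochastic_mxP[K0 K1] xb i; rewrite mxE; apply/andP; split.
  rewrite -[lo]mul1r -(K1 i) mulr_suml; apply: ler_sum => j _.
  by rewrite ler_wpM2l //; case/andP: (xb j).
rewrite -[hi]mul1r -(K1 i) mulr_suml; apply: ler_sum => j _.
by rewrite ler_wpM2l //; case/andP: (xb j).
Qed.

Lemma doeblin_bounds K x (e lo hi : R) j : stochastic_mx K ->
  (forall i, e <= K i j) -> (forall i, lo <= x i 0 <= hi) ->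
  forall i, e * x j 0 + (1 - e) * lo <= (K *m x) i 0
            <= e * x j 0 + (1 - e) * hi.
Proof.
move=> /stochastic_mxP[K0 K1] Kj xb i.
have sum c : \sum_l K i l * (x l 0 - c) = (K *m x) i 0 - c.
  under eq_bigr do rewrite mulrBr.
  by rewrite sumrB -mulr_suml K1 mul1r mxE.
apply/andP; split.
  suff : e * (x j 0 - lo) <= (K *m x) i 0 - lo by lra.
  rewrite -sum (bigD1 j) //= -[leLHS]addr0; apply: lerD.
    by rewrite ler_wpM2r // subr_ge0; case/andP: (xb j).
  apply: sumr_ge0 => l _; rewrite mulr_ge0 // subr_ge0.
  by case/andP: (xb l).
suff : (K *m x) i 0 - hi <= e * (x j 0 - hi) by lra.
rewrite -sum (bigD1 j) //= -[leRHS]addr0; apply: lerD.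
  by rewrite ler_wnM2r // subr_le0; case/andP: (xb j).
apply: sumr_le0 => l _; rewrite mulr_ge0_le0 // subr_le0.
by case/andP: (xb l).
Qed.

(** Each block of [n0] steps shrinks the oscillation of [K ^+ m *m y] by the
    factor [1 - e], and a step moves an entry by at most the oscillation. *)
Lemma doeblin_increment_cvg0 K (e : R) n0 j y : stochastic_mx K -> 0 < e ->
  (forall i, e <= (K ^+ n0) i j) ->
  forall i, (K ^+ m.+1 *m y - K ^+ m *m y) i 0 @[m --> \oo] --> (0 : R).
Proof.
move=> Ks e0 Kj i.
have e1 : e <= 1.
  apply: le_trans (Kj j) _.
  have /stochastic_mxP[K0 K1] := expmx_stochastic n0 Ks.
  rewrite -(K1 j) (bigD1 j) //= lerDl; exact: sumr_ge0.
pose D := \sum_l `|y l 0|.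
have osc q : exists lo hi, hi - lo <= (1 - e) ^+ q * (2 * D) /\
    forall m, (q * n0 <= m)%N -> forall i, lo <= (K ^+ m *m y) i 0 <= hi.
  elim: q => [|q [lo [hi [hl b]]]].
    exists (- D), D; split; first by rewrite expr0; lra.
    move=> m _; apply: stochastic_bounds; first exact: expmx_stochastic.
    move=> l; rewrite -ler_norml /D (bigD1 l) //= lerDl; exact: sumr_ge0.
  pose z := K ^+ (q * n0) *m y.
  exists (e * z j 0 + (1 - e) * lo), (e * z j 0 + (1 - e) * hi); split.
    have : (1 - e) * (hi - lo) <= (1 - e) * ((1 - e) ^+ q * (2 * D)).
      by rewrite ler_wpM2l // subr_ge0.
    rewrite exprS; lra.
  move=> m qm; rewrite -(subnK qm) exprD -mulmxA.
  apply: stochastic_bounds; first exact: expmx_stochastic.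
  rewrite mulSn exprD -mulmxA; apply: doeblin_bounds => //.
    exact: expmx_stochastic.
  exact: b.
apply/cvgr0Pnorm_lt => eps eps0.
have /cvgrPdist_lt/(_ _ eps0) : (1 - e) ^+ q * (2 * D) @[q --> \oo] --> 0 * (2 * D).
  by apply: cvgM; [apply: cvg_expr; rewrite ger0_norm; lra | exact: cvg_cst].
rewrite mul0r => -[q _ /(_ q (leqnn q))]; rewrite /= sub0r normrN => qe.
have [lo [hi [hl b]]] := osc q.
near=> m; have qm : (q * n0 <= m)%N by near: m; exact: nbhs_infty_ge.
rewrite exprS -mulmxA mxE [X in _ + X]mxE.
have /(_ i) := stochastic_bounds Ks (b m qm); have := b m qm i.
move: (K ^+ m *m y) => v; move: (K *m v) => u.
have : (1 - e) ^+ q * (2 * D) < eps by apply: le_lt_trans qe; exact: ler_norm.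
move=> h1 /andP[h2 h3] /andP[h4 h5]; rewrite ltr_norml; apply/andP; split; lra.
Unshelve. all: by end_near. Qed.

(** Return times to a state [j] of the class contain all large integers, so a
    common time works for reaching [j] from every state. *)
Lemma aperiodic_doeblin K (C : {set 'I_n}) : stochastic_mx K ->
  closed_comm_class K C -> aperiodic_class K C ->
  (forall i, exists2 j, j \in C & accessible K i j) ->
  exists n0 j e, 0 < e /\ forall i, e <= (K ^+ n0) i j.
Proof.
move=> Ks [/set0Pn[j jC] Ccomm _] Cap reach.
have /stochastic_mxP[K0 _] := Ks.
have reachj i : accessible K i j.
  have [l lC [a il]] := reach i; have [b lj] := Ccomm _ _ lC jC.
  by exists (a + b)%N; apply: expmx_add_gt0 lj.
have [n1 pos] : exists n1, forall m, (n1 <= m)%N -> 0 < (K ^+ m) j j.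
  apply: (@additive_gcd1_cofinite (fun m => 0 < (K ^+ m) j j)).
  - by rewrite expr0 mxE eqxx ltr01.
  - by move=> a b; apply: expmx_add_gt0.
  - by case: (Cap j jC).
have /choice[a aP] := reachj.
have posi i : 0 < (K ^+ (n1 + \max_i a i)) i j.
  have ai : (a i <= \max_i a i)%N by exact: leq_bigmax.
  rewrite -{1}(subnK (leq_trans ai (leq_addl n1 _))) addnC.
  apply: expmx_add_gt0 (aP i) _ => //; apply: pos.
  by rewrite -addnBA // leq_addr.
move: (n1 + _)%N posi => N posi; exists N, j.
exists (\big[Num.min/1]_i (K ^+ N) i j); split.
  by elim/big_ind: _ => // u v u0 v0; rewrite lt_min u0.
by move=> i; rewrite (bigD1 i) //= ge_min lexx.
Qed.

End FiniteChains.

Section Fredholm.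
Context {R : realType} {T : finType}.

(** There is one unknown more than there are equations, so by rank-nullity a
    kernel contained in the line of constant functions makes the rank full. *)
Lemma fredholm_surj (F : (T -> R) -> R -> T -> R) :
  (forall (a c d : R) (x y : T -> R) t,
     F (fun s => a * x s + y s) (a * c + d) t = a * F x c t + F y d t) ->
  (forall x c, (forall t, F x c t = 0) -> c = 0 /\ forall s t, x s = x t) ->
  forall b : T -> R, exists x c, forall t, F x c t = b t.
Proof.
move=> Flin Fker b; pose N := #|T|.
pose xv (v : 'rV[R]_(1 + N)) t := v 0 (rshift 1 (enum_rank t)).
pose cv (v : 'rV[R]_(1 + N)) := v 0 (lshift N 0).
pose f (v : 'rV[R]_(1 + N)) : 'rV[R]_N := \row_j F (xv v) (cv v) (enum_val j).
have flin : linear f.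
  move=> a u v; apply/rowP => j; rewrite !mxE -Flin.
  congr (F _ _ _); last by rewrite /cv !mxE.
  by apply/funext => t; rewrite /xv !mxE.
pose fL : {linear 'rV[R]_(1 + N) -> 'rV[R]_N} :=
  HB.pack f (GRing.isLinear.Build _ _ _ _ f flin).
have fE v : v *m lin1_mx f = f v by rewrite (mul_rV_lin1 fL).
have kle : (kermx (lin1_mx f) <= (row_mx 0 (const_mx 1) : 'rV[R]_(1 + N)))%MS.
  apply/rV_subP => v /sub_kermxP; rewrite fE => fv.
  have [t|c0 xcst] := Fker (xv v) (cv v).
    by have /rowP/(_ (enum_rank t)) := fv; rewrite !mxE enum_rankK.
  have v0 : lsubmx v = 0.
    by apply/rowP => j; rewrite !mxE ord1.
  case: (pickP T) => [t0 _|noT].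
    apply/submxP; exists (xv v t0)%:M; rewrite mul_scalar_mx -[LHS]hsubmxK v0.
    rewrite scale_row_mx scaler0; congr row_mx.
    apply/rowP => j; rewrite !mxE mulr1.
    by have := xcst (enum_val j) t0; rewrite /xv enum_valK.
  have -> : v = 0 by rewrite -[v]hsubmxK v0; apply/rowP => j;
    rewrite !mxE; case: splitP => [j' _|j' _]; rewrite !mxE //;
    have := noT (enum_val j').
  exact: sub0mx.
have rk : (N <= \rank (lin1_mx f))%N.
  have := leq_trans (mxrankS kle) (rank_leq_row _).
  by rewrite mxrank_ker; lia.
have full : row_full (lin1_mx f) by rewrite /row_full eqn_leq rank_leq_col.
have /submxP[v vb] := submx_full (\row_j b (enum_val j)) full.
exists (xv v), (cv v) => t; have /rowP/(_ (enum_rank t)) := vb.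
by rewrite fE !mxE enum_rankK => ->.
Qed.

End Fredholm.

(** * Rows of an M/G/1-type matrix and of its truncations *)

Section BlockRows.
Context {R : realType} {M0 M1 : nat}.
Local Notation S := (mg1_state M0 M1).
Local Notation st k i := (existT (fun l => 'I_(level_size M0 M1 l)) k i : S).
Implicit Types (Q : mg1_blocks R M0 M1) (f : S -> R) (k m n N : nat).

(** [jump Q k m] is the block of the upward jumps of size [m] from level [k]. It
    is meaningful for [m > 0] only, [blkB Q 0] being arbitrary. *)
Definition jump Q k : nat -> 'M[R]_(level_size M0 M1 k, M1) :=
  match k with 0 => blkB Q | _.+1 => blkA Q end.

Lemma mg1_up Q k m i (j : 'I_M1) :
  mg1_matrix Q (st k i) (st (k + m).+1 j) = jump Q k m.+1 i j.
Proof.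
case: k i => [|[|k]] i //.
change ((if (k.+1 <= k.+2 + m)%N then blkA Q (k.+2 + m - k.+1)
  else if k.+1 == (k.+2 + m).+1 then blkAm1 Q else 0) i j = blkA Q m.+1 i j).
by rewrite ifT; [congr (blkA Q _ i j) |]; lia.
Qed.

Lemma psum_row Q k i f n :
  psum (fun t => mg1_matrix Q (st k i) t * f t) (k.+1 + n) =
  psum (fun t => mg1_matrix Q (st k i) t * f t) k.+1 +
  \sum_(0 <= m < n) \sum_j jump Q k m.+1 i j * f (st (k + m).+1 j).
Proof.
rewrite {1}/psum (@big_cat_nat _ _ _ k.+1) //= ?leq_addr //; congr (_ + _).
rewrite [LHS](big_addn 0 (k.+1 + n) k.+1) addKn; apply: eq_bigr => m _.
rewrite addnS addnC; apply: eq_bigr => j _.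
by congr (_ * _); rewrite -mg1_up.
Qed.

Lemma cvg_psum_row Q k i f (x : R) :
  \sum_(0 <= m < n) (\sum_j jump Q k m.+1 i j * f (st (k + m).+1 j))
    @[n --> \oo] --> x ->
  psum (fun t => mg1_matrix Q (st k i) t * f t) @ \oo -->
    psum (fun t => mg1_matrix Q (st k i) t * f t) k.+1 + x.
Proof.
move=> fx; rewrite -(cvg_shiftn k.+1).
under eq_fun do rewrite /= addnC psum_row.
by apply: cvgD => //; exact: cvg_cst.
Qed.

Lemma psum_row_cvg Q k i f (x : R) :
  psum (fun t => mg1_matrix Q (st k i) t * f t) @ \oo --> x ->
  \sum_(0 <= m < n) (\sum_j jump Q k m.+1 i j * f (st (k + m).+1 j))
    @[n --> \oo] -->
    x - psum (fun t => mg1_matrix Q (st k i) t * f t) k.+1.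
Proof.
rewrite -(cvg_shiftn k.+1); under eq_fun do rewrite /= addnC psum_row.
move=> fx; have : (psum (fun t => mg1_matrix Q (st k i) t * f t) k.+1 +
    \sum_(0 <= m < n) (\sum_j jump Q k m.+1 i j * f (st (k + m).+1 j)) -
    psum (fun t => mg1_matrix Q (st k i) t * f t) k.+1) @[n --> \oo] -->
    x - psum (fun t => mg1_matrix Q (st k i) t * f t) k.+1.
  by apply: cvgB => //; exact: cvg_cst.
apply: cvg_trans; apply: near_eq_cvg; near=> n.
by rewrite addrAC subrr add0r.
Unshelve. all: by end_near. Qed.

Section Stochastic.
Variable Q : mg1_blocks R M0 M1.
Hypothesis hP : stochastic (mg1_matrix Q).

Lemma jump_ge0 k m i j : 0 <= jump Q k m.+1 i j.
Proof. by rewrite -mg1_up; case: hP. Qed.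

Lemma blkA_ge0 m i j : 0 <= blkA Q m i j.
Proof.
case: hP => /(_ (st 1 i) (st m.+1 j)) + _.
by rewrite /mg1_matrix /= subn0.
Qed.

Lemma blkAm1_ge0 i j : 0 <= blkAm1 Q i j.
Proof. by case: hP => /(_ (st 2 i) (st 1 j)). Qed.

Lemma jump_cvg k i j : cvgn (fun n => \sum_(0 <= m < n) jump Q k m.+1 i j).
Proof.
apply: (@dom_sum_cvg _ _ (fun m => \sum_j jump Q k m.+1 i j * 1)) => [m|].
  rewrite ger0_norm ?jump_ge0 // (bigD1 j) //= mulr1 lerDl.
  by apply: sumr_ge0 => l _; rewrite mulr1 jump_ge0.
exact: cvgP _ (psum_row_cvg (@cst_row_cvg _ _ _ _ hP 1 (st k i))).
Qed.

Lemma tail_jump k m i j :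
  \sum_(m <= l < n) jump Q k l.+1 i j @[n --> \oo] --> tail (jump Q k) m i j.
Proof.
have : mx_summable m.+1 (jump Q k).
  apply/mx_summableP => a b; apply: is_cvg_sum_from.
  have /is_cvg_sum_from := @jump_cvg k a b => /(_ 0%N)/cvg_ex[x jx].
  apply: (@cvgP _ _ (jump Q k 0 a b + x)); rewrite -cvg_shiftS /=.
  under eq_fun do rewrite big_nat_recl //.
  by apply: cvgD => //; exact: cvg_cst.
move=> /cvg_mx_sum/(_ i j); rewrite -cvg_shiftS /=.
by under eq_fun do rewrite big_add1 /=.
Qed.

Lemma tail_jump_ge0 k m i j : 0 <= tail (jump Q k) m i j.
Proof.
apply: (cvgr_to_ge (@tail_jump k m i j)); near=> n.
by apply: sumr_ge0 => l _; exact: jump_ge0.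
Unshelve. all: by end_near. Qed.

Variable N : nat.
Hypothesis N0 : (0 < N)%N.

Lemma LI_jump k m : jump (LI_blocks Q N) k m =
  if (m < N)%N then jump Q k m else if m == N then tail (jump Q k) N.-1 else 0.
Proof. by case: k. Qed.

Lemma LI_low k i f :
  psum (fun t => mg1_matrix (LI_blocks Q N) (st k i) t * f t) k.+1 =
  psum (fun t => mg1_matrix Q (st k i) t * f t) k.+1.
Proof.
apply: eq_big_nat => l /= lk; apply: eq_bigr => j _; congr (_ * _).
rewrite /mg1_matrix /=; case: k l i j lk => [|[|k]] [|l] //= i j lk.
  by case: l j lk => //= j _; rewrite N0.
case: ifP => // kl; have -> : (l - k.+1 = 0)%N by lia.
by rewrite N0.
Qed.

(** The truncated row collects on level [k + N] all the mass that the row of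
    [Q] sends above it. The two images of [f] therefore differ by the variation
    of [f] above that level, and this difference is all that is used later. *)
Lemma LI_row k i f (x : R) :
  psum (fun t => mg1_matrix Q (st k i) t * f t) @ \oo --> x ->
  exists2 y, psum (fun t => mg1_matrix (LI_blocks Q N) (st k i) t * f t)
               @ \oo --> y &
    \sum_(N.-1 <= m < n) (\sum_j jump Q k m.+1 i j *
        (f (st (k + m).+1 j) - f (st (k + N.-1).+1 j))) @[n --> \oo] --> x - y.
Proof.
move=> fx; pose low := psum (fun t => mg1_matrix Q (st k i) t * f t) k.+1.
pose F m := \sum_j jump Q k m.+1 i j * f (st (k + m).+1 j).
pose last := \sum_j tail (jump Q k) N.-1 i j * f (st (k + N.-1).+1 j).
exists (low + (\sum_(0 <= m < N.-1) F m + last)).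
  rewrite /low -(@LI_low k i f); apply: cvg_psum_row.
  have E : \forall n \near \oo, \sum_(0 <= m < n) (\sum_j
      jump (LI_blocks Q N) k m.+1 i j * f (st (k + m).+1 j)) =
      \sum_(0 <= m < N.-1) F m + last.
    near=> n; have nN : (N <= n)%N by near: n; exact: nbhs_infty_ge.
    rewrite (@big_cat_nat _ _ _ N.-1) //=; last by lia.
    congr (_ + _).
      rewrite !big_nat; apply: eq_bigr => m /= mN; apply: eq_bigr => j _.
      by rewrite LI_jump ifT //; lia.
    rewrite big_ltn; last by lia.
    rewrite LI_jump prednK // ltnn eqxx [X in _ + X = _]big_nat [X in _ + X = _]big1 ?addr0 //.
    move=> m mN; apply: big1 => j _; rewrite LI_jump ifF; last by lia.
    by rewrite ifF ?mxE ?mul0r //; lia.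
  apply: cvg_near_cst; exact: E.
have h1 := cvg_sum_from (l := N.-1) (psum_row_cvg fx).
have h2 : (\sum_j (\sum_(N.-1 <= m < n) jump Q k m.+1 i j) *
    f (st (k + N.-1).+1 j)) @[n --> \oo] --> last.
  by apply: cvg_finsum => j; apply: cvgM; [exact: tail_jump | exact: cvg_cst].
have := cvg_seqB h1 h2; rewrite -/low -/F.
have -> : x - low - \sum_(0 <= k < N.-1) F k - last =
  x - (low + (\sum_(0 <= m < N.-1) F m + last)) by ring.
apply: cvg_trans; apply: near_eq_cvg; near=> n; rewrite /=.
under [X in _ - X = _]eq_bigr do rewrite mulr_suml.
rewrite [X in _ - X]exchange_big /= -sumrB; apply: eq_bigr => m _.
by rewrite -sumrB; apply: eq_bigr => j _; rewrite mulrBr.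
Unshelve. all: by end_near. Qed.

(** Truncation moves mass without losing any: constants have defect zero. *)
Lemma LI_stochastic : stochastic (mg1_matrix (LI_blocks Q N)).
Proof.
have P0 := fun s t => (hP.1 s t).
have LI0 s t : 0 <= mg1_matrix (LI_blocks Q N) s t.
  case: s t => k i [l j]; have [kl|lk] := ltnP k l.
    have lE : l = (k + (l - k.+1)).+1 by lia.
    move: j; rewrite lE => j; rewrite mg1_up LI_jump.
    by do 2?case: ifP => _; rewrite ?jump_ge0 ?tail_jump_ge0 ?mxE.
  have := P0 (st k i) (st l j); rewrite /mg1_matrix /=.
  case: k l i j lk => [|[|k]] [|l] //= i j lk.
    by case: l j lk => //= j _; rewrite N0.
  case: ifP => // kl; have -> : (l - k.+1 = 0)%N by lia.
  by rewrite N0.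
split=> // -[k i].
have [y cy] := LI_row (@cst_row_cvg _ _ _ _ hP 1 (st k i)).
under eq_fun do under eq_bigr do under eq_bigr do rewrite subrr mulr0.
have -> : (fun n : nat => \sum_(N.-1 <= m < n) \sum_(j < M1) (0 : R))
    = fun=> 0.
  by apply/funext => n; rewrite big1 // => m _; rewrite big1.
move=> h0; have y1 : 1 - y = 0 by apply: (cvg_unique _ h0 (cvg_cst 0)).
apply: cvg_psum_esum => //; have -> : 1 = y by move/eqP: y1; rewrite subr_eq0 => /eqP.
apply: cvg_trans cy; apply: near_eq_cvg; near=> n.
by apply: eq_psum => t; rewrite mulr1.
Unshelve. all: by end_near. Qed.

End Stochastic.

End BlockRows.

(** * Negative drift and uniform bounds on the mean level *)

Section Drift.
Context {R : realType} {M0 M1 : nat}.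
Local Notation S := (mg1_state M0 M1).
Local Notation st k i := (existT (fun l => 'I_(level_size M0 M1 l)) k i : S).
Implicit Types (f : S -> R) (k m n N : nat).

(** Functions on the states are prescribed by column vectors, one per level;
    [u l] belongs to level [l.+1], all positive levels having [M1] phases. *)
Definition by_level (u0 : 'cV[R]_M0) (u : nat -> 'cV[R]_M1) : S -> R :=
  fun s => let: existT k i := s in
    (match k return 'I_(level_size M0 M1 k) -> R with
     | 0 => fun i => u0 i 0 | l.+1 => fun i => u l i 0 end) i.

Variable Q : mg1_blocks R M0 M1.
Hypothesis hP : stochastic (mg1_matrix Q).
Hypothesis jump_sq_cvg : forall k i j,
  cvgn (fun n => \sum_(0 <= m < n) m.+1%:R ^+ 2 * jump Q k m.+1 i j).

Let P0 s t : 0 <= mg1_matrix Q s t. Proof. by case: hP. Qed.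

Lemma quadratic_row_cvg f (c : R) : (forall s, `|f s| <= c * (tag s).+1%:R ^+ 2) ->
  forall s, cvgn (psum (fun t => mg1_matrix Q s t * f t)).
Proof.
move=> fc [k i]; pose g (t : S) := c * (tag t).+1%:R ^+ 2.
have c0 : 0 <= c.
  have := le_trans (normr_ge0 _) (fc (st k i)).
  by rewrite pmulr_lge0 // exprn_gt0.
have g0 t : 0 <= g t by rewrite mulr_ge0 // exprn_ge0.
apply: (@psum_dom_cvg _ _ _ _ (fun t => mg1_matrix Q (st k i) t * g t)) => [t|].
  by rewrite normrM (ger0_norm (P0 _ _)) ler_wpM2l.
suff /cvg_ex[x gx] : cvgn (fun n => \sum_(0 <= m < n)
    (\sum_j jump Q k m.+1 i j * g (st (k + m).+1 j))).
  exact: cvgP _ (cvg_psum_row gx).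
pose D := c * k.+2%:R ^+ 2.
apply: (@dom_sum_cvg _ _ (fun m => \sum_j D *
    (m.+1%:R ^+ 2 * jump Q k m.+1 i j))) => [m|].
  rewrite ger0_norm; last by apply: sumr_ge0 => j _; rewrite mulr_ge0 ?jump_ge0.
  apply: ler_sum => j _; rewrite mulrC mulrA ler_wpM2r ?jump_ge0 // /g /D /=.
  rewrite -mulrA ler_wpM2l // -exprMn -natrM ler_pXn2r ?nnegrE // ler_nat.
  by lia.
have /choice[l jl] j : exists l, \sum_(0 <= m < n)
    (D * (m.+1%:R ^+ 2 * jump Q k m.+1 i j)) @[n --> \oo] --> (l : R).
  have /cvg_ex[l jl] := @jump_sq_cvg k i j.
  by exists (D * l); have := @cvg_seqZ _ D _ _ jl; under eq_fun do rewrite mulr_sumr.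
apply: (@cvgP _ _ (\sum_j l j)).
by under eq_fun do rewrite exchange_big /=; exact: cvg_finsum.
Qed.

Lemma A_sq_summable : mx_summable 0 (fun m => m%:R ^+ 2 *: blkA Q m).
Proof.
apply/mx_summableP => i j; have /cvg_ex[x jx] := @jump_sq_cvg 1%N i j.
apply: (@cvgP _ _ (0 + x)); rewrite -cvg_shiftS /=.
under eq_fun do rewrite big_nat_recl //; apply: cvgD.
  by rewrite mxE expr0n mul0r; exact: cvg_cst.
by under eq_fun do under eq_bigr do rewrite mxE.
Qed.

Lemma A_mean_summable : mx_summable 0 (fun m => m%:R *: blkA Q m).
Proof.
have /mx_summableP := A_sq_summable => A2.
apply/mx_summableP => i j; apply: dom_sum_cvg (A2 i j) => m; rewrite !mxE.
rewrite ger0_norm ?mulr_ge0 ?blkA_ge0 //.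
rewrite ler_wpM2r ?blkA_ge0 // -natrX ler_nat -mulnn; nia.
Qed.

Lemma A_summable : mx_summable 0 (blkA Q).
Proof.
apply/mx_summableP => i j; have /cvg_ex[x jx] := @jump_cvg _ _ _ _ hP 1%N i j.
apply: (@cvgP _ _ (blkA Q 0 i j + x)); rewrite -cvg_shiftS /=.
under eq_fun do rewrite big_nat_recl //; apply: cvgD => //.
exact: cvg_cst.
Qed.

Local Notation T0 := (mx_sum 0 (blkA Q)).
Local Notation T1 := (mx_sum 0 (fun m => m%:R *: blkA Q m)).
Local Notation T2 := (mx_sum 0 (fun m => m%:R ^+ 2 *: blkA Q m)).
Local Notation e := (const_mx 1 : 'cV[R]_M1).

Lemma A_quadratic_cvg (c0 c1 c2 : 'cV[R]_M1) :
  \sum_(0 <= m < n) blkA Q m *m (c0 + m%:R *: c1 + m%:R ^+ 2 *: c2)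
    @[n --> \oo] --> T0 *m c0 + T1 *m c1 + T2 *m c2.
Proof.
have h0 := cvg_mulmxl (V := c0) A_summable.
have h1 := cvg_mulmxl (V := c1) A_mean_summable.
have h2 := cvg_mulmxl (V := c2) A_sq_summable.
apply/cvg_mxP => i j; rewrite 2!mxE.
move/cvg_mxP: h0 => /(_ i j) h0; move/cvg_mxP: h1 => /(_ i j) h1.
move/cvg_mxP: h2 => /(_ i j) h2.
have := cvg_seqD (cvg_seqD h0 h1) h2.
apply: cvg_trans; apply: near_eq_cvg; near=> n.
rewrite !mulmx_suml !summxE -!big_split /=; apply: eq_bigr => m _.
by rewrite !mulmxDr -!scalemxAr -!scalemxAl !mxE.
Unshelve. all: by end_near. Qed.

Lemma meanA_E : meanA Q = - (blkAm1 Q *m const_mx 1) + T1 *m e.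
Proof.
congr (_ + _); apply/matrixP => i j.
have h : \sum_(0 <= k < n) (k%:R *: (blkA Q k *m e)) i j @[n --> \oo]
    --> (T1 *m e) i j.
  have /cvg_mxP/(_ i j) := cvg_mulmxl (V := e) A_mean_summable.
  apply: cvg_trans; apply: near_eq_cvg; near=> n.
  rewrite mulmx_suml !summxE; apply: eq_bigr => m _.
  by rewrite -scalemxAl.
have h1 := cvg_sum_from (l := 1%N) h.
have z : (0%:R *: (blkA Q 0 *m e)) i j = 0 by rewrite scale0r mxE.
rewrite big_nat1 z subr0 in h1.
apply: (cvg_unique _ _ h1) => //; apply: cvg_mx_sum.
apply/mx_summableP => a b; apply: is_cvg_sum_from.
have /cvg_mxP/(_ a b) h' := cvg_mulmxl (V := e) A_mean_summable.
apply: (@cvgP _ _ ((T1 *m e) a b)); move: h'.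
apply: cvg_trans; apply: near_eq_cvg; near=> n.
rewrite mulmx_suml !summxE; apply: eq_bigr => m _.
by rewrite -scalemxAl.
Unshelve. all: by end_near. Qed.

Lemma psum_row_interior k i f (u : nat -> 'cV[R]_M1) (w : 'cV[R]_M1) :
  (forall l j, f (st l.+1 j) = u l j 0) ->
  \sum_(0 <= m < n) blkA Q m *m u (k.+1 + m)%N @[n --> \oo] --> w ->
  psum (fun t => mg1_matrix Q (st k.+2 i) t * f t) @ \oo -->
    (blkAm1 Q *m u k + w) i 0.
Proof.
move=> fu /cvg_mxP/(_ i 0) uw; rewrite mxE.
have -> : (blkAm1 Q *m u k) i 0 + w i 0 =
    ((blkAm1 Q *m u k) i 0 + (blkA Q 0 *m u k.+1) i 0)
    + (w i 0 - (blkA Q 0 *m u k.+1) i 0) by ring.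
have -> : (blkAm1 Q *m u k) i 0 + (blkA Q 0 *m u k.+1) i 0 =
    psum (fun t => mg1_matrix Q (st k.+2 i) t * f t) k.+3.
  rewrite /psum big_nat_recr // big_nat_recr //= big_nat big1 ?add0r; last first.
    move=> l /= lk; apply: big1 => j _; rewrite /mg1_matrix /=.
    case: l lk j => [|l] lk j; first by rewrite mxE mul0r.
    rewrite ifF; last by lia.
    rewrite ifF; last by lia.
    by rewrite mxE mul0r.
  congr (_ + _); rewrite mxE; apply: eq_bigr => j _;
    rewrite -fu /mg1_matrix /=.
    by rewrite ltnn eqxx.
  by rewrite leqnn subnn.
apply: cvg_psum_row.
have := cvg_sum_from (l := 1%N) (x := fun m => (blkA Q m *m u (k.+1 + m)%N) i 0).
move=> /(_ (w i 0)); rewrite big_nat1 addn0.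
have {}uw : \sum_(0 <= m < n) (blkA Q m *m u (k.+1 + m)%N) i 0
    @[n --> \oo] --> w i 0.
  by under eq_fun do rewrite -summxE.
move=> /(_ uw); rewrite -cvg_shiftS.
apply: cvg_trans; apply: near_eq_cvg; near=> n.
rewrite /= big_add1 /=; apply: eq_bigr => m _; rewrite mxE.
by apply: eq_bigr => j _; rewrite -fu addnS.
Unshelve. all: by end_near. Qed.

Variable varpi : 'rV[R]_M1.
Hypothesis hA : irreducible_mx (sumA Q) /\ stochastic_mx (sumA Q).
Hypothesis hvarpi : stationary_mx (sumA Q) varpi.

Local Notation sigma := (drift Q varpi).

(** The correction making [k + a i] a function with the constant drift
    [sigma] away from the boundary. *)
Lemma drift_corrector : exists a : 'cV[R]_M1,
  (forall i, 0 <= a i 0) /\ sumA Q *m a + meanA Q = a + sigma *: e.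
Proof.
have [_ varpi1 varpiA] := hvarpi; have [irr stoch] := hA.
pose F (x : 'I_M1 -> R) (c : R) (t : 'I_M1) :=
  ((\col_j x j) - sumA Q *m (\col_j x j) + c *: e) t 0.
have varpiF x c : (forall t, F x c t = 0) -> c = 0.
  move=> F0; have E : (\col_j x j) - sumA Q *m (\col_j x j) + c *: e = 0.
    by apply/matrixP => i j; rewrite ord1 [LHS]F0 mxE.
  have := congr1 (mulmx varpi) E.
  rewrite mulmx0 mulmxDr mulmxBr mulmxA varpiA subrr add0r -scalemxAr varpi1.
  by move=> /matrixP/(_ 0 0); rewrite !mxE mulr1n mulr1.
have [|x c F0|x [c xb]] := @fredholm_surj _ _ F _ _ (fun t => meanA Q t 0).
- move=> a c d x y t; rewrite /F.
  have -> : \col_j (a * x j + y j) = a *: \col_j x j + \col_j y j.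
    by apply/colP => j; rewrite !mxE.
  rewrite mulmxDr -scalemxAr; move: (\col_j x j) (\col_j y j) => X Y.
  move: (sumA Q *m X) (sumA Q *m Y) => X' Y'; rewrite !mxE; ring.
- have c0 := varpiF _ _ F0; split=> //.
  move=> s t; have := @harmonic_mx_cst _ _ (sumA Q) (\col_j x j) stoch irr.
  move=> /(_ _ s t); rewrite !mxE; apply; apply/esym/eqP.
  rewrite -subr_eq0; apply/eqP/matrixP => i j; rewrite ord1.
  by have := F0 i; rewrite /F c0 scale0r addr0 => ->; rewrite mxE.
have E : (\col_j x j) - sumA Q *m (\col_j x j) + c *: e = meanA Q.
  by apply/matrixP => i j; rewrite ord1; exact: xb.
have cE : c = sigma.
  rewrite /drift -E mulmxDr mulmxBr mulmxA varpiA subrr add0r -scalemxAr varpi1.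
  by rewrite !mxE mulr1n mulr1.
pose L := \sum_j `|x j|.
exists ((\col_j x j) + L *: e); split.
  move=> i; rewrite !mxE mulr1 /L (bigD1 i) //=.
  have : - x i <= `|x i| by rewrite -normrN ler_norm.
  have : 0 <= \sum_(j < M1 | j != i) `|x j| by exact: sumr_ge0.
  lra.
have [_ A1] := stoch.
rewrite mulmxDr -scalemxAr A1 -E -cE.
move: (\col_j x j) => v; move: (sumA Q *m v) => u.
by apply/matrixP => i j; rewrite !mxE; ring.
Qed.

Variable a : 'cV[R]_M1.
Hypothesis a_ge0 : forall i, 0 <= a i 0.
Hypothesis aE : sumA Q *m a + meanA Q = a + sigma *: e.

(** The equation for [a] says that the level process maps the function
    [(c + k) + a i] to itself plus [sigma]; here it is solved for the series. *)
Lemma A_linear_cvg (c : R) k :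
  \sum_(0 <= m < n) blkA Q m *m ((c + (k + m)%:R) *: e + a) @[n --> \oo] -->
  (c + k%:R) *: e + a + sigma *: e
   - blkAm1 Q *m ((c + k%:R - 1) *: e + a).
Proof.
have := @A_quadratic_cvg ((c + k%:R) *: e + a) e 0.
have [_ A1] := hA.2; have := aE; have := A1; rewrite meanA_E /sumA !mulmxDl.
rewrite !mulmxDr -!scalemxAr mulmx0 addr0.
move: (T0 *m e) (T0 *m a) (T1 *m e) (blkAm1 Q *m e) (blkAm1 Q *m a).
move=> t0 t0a t1 b ba eE aE'.
have -> : (c + k%:R) *: t0 + t0a + t1 =
    (c + k%:R) *: e + a + sigma *: e - ((c + k%:R - 1) *: b + ba).
  move/matrixP: eE => eE; move/matrixP: aE' => aE'.
  apply/matrixP => i j; have := aE' i j; have := eE i j; rewrite !mxE.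
  move=> E1 E2; have -> : t0a i j = a i j + sigma * 1 - ba i j + b i j - t1 i j.
    by rewrite -E2; ring.
  have -> : t0 i j = 1 - b i j by rewrite -E1; ring.
  by ring.
apply: cvg_trans; apply: near_eq_cvg; near=> n.
apply: eq_bigr => m _; congr (_ *m _).
by apply/matrixP => i j; rewrite !mxE natrD; ring.
Unshelve. all: by end_near. Qed.

(** The Lyapunov function [k ^ 2 + 2 k (a i)]: the term linear in [k] makes its
    drift off the boundary exactly [2 * sigma * k] plus a function of the
    phase. *)
Let V := by_level 0 (fun l => l.+1%:R ^+ 2 *: e + (2 * l.+1%:R) *: a).

Let VE k i : V (st k.+1 i) = k.+1%:R ^+ 2 + 2 * k.+1%:R * a i 0.
Proof. by rewrite /V /= !mxE mulr1. Qed.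

Let V_ge0 s : 0 <= V s.
Proof.
case: s => [[|k] i]; first by rewrite /V /= mxE.
by rewrite VE addr_ge0 ?exprn_ge0 ?mulr_ge0.
Qed.

Let c2 := - (2 *: (blkAm1 Q *m a)) + blkAm1 Q *m e + 2 *: (T1 *m a) + T2 *m e.

Let V_row k i : psum (fun t => mg1_matrix Q (st k.+2 i) t * V t) @ \oo -->
  V (st k.+2 i) + 2 * sigma * k.+2%:R + c2 i 0.
Proof.
pose u l := l.+1%:R ^+ 2 *: e + (2 * l.+1%:R) *: a.
have -> : V (st k.+2 i) + 2 * sigma * k.+2%:R + c2 i 0 =
    (blkAm1 Q *m u k + (T0 *m u k.+1 +
      T1 *m ((2 * k.+2%:R) *: e + 2 *: a) + T2 *m e)) i 0.
  have [_ A1] := hA.2; have := aE; have := A1; rewrite meanA_E /sumA !mulmxDl.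
  rewrite VE /c2 /u !mulmxDr -!scalemxAr.
  move: (T0 *m e) (T0 *m a) (T1 *m e) (T1 *m a) (T2 *m e).
  move: (blkAm1 Q *m e) (blkAm1 Q *m a).
  move=> b ba t0 t0a t1 t1a t2.
  move=> /matrixP/(_ i 0) E1 /matrixP/(_ i 0) E2; move: E1 E2; rewrite !mxE.
  move=> E1 E2; have -> : t0a i 0 = a i 0 + sigma * 1 - ba i 0 + b i 0 - t1 i 0.
    by rewrite -E2; ring.
  have -> : t0 i 0 = 1 - b i 0 by rewrite -E1; ring.
  by rewrite -(natr1 k.+1); ring.
apply: (psum_row_interior (u := u)); first by [].
have := @A_quadratic_cvg (u k.+1) ((2 * k.+2%:R) *: e + 2 *: a) e.
apply: cvg_trans; apply: near_eq_cvg; near=> n.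
apply: eq_bigr => m _; congr (_ *m _).
apply/matrixP => x y; rewrite !mxE.
have -> : (k.+1 + m).+1%:R = k.+2%:R + m%:R :> R by rewrite -natrD.
by ring.
Unshelve. all: by end_near. Qed.

Hypothesis sigma_lt0 : sigma < 0.

Let sigma2_gt0 : 0 < - 2 * sigma.
Proof. by move: sigma_lt0; move: sigma => x; lra. Qed.

Let g (s : S) : R := - 2 * sigma * (tag s)%:R.

Let g_ge0 s : 0 <= g s.
Proof. by rewrite /g mulr_ge0 // ltW. Qed.

Let V_cvg s : cvgn (psum (fun t => mg1_matrix Q s t * V t)).
Proof.
apply: (@quadratic_row_cvg _ (1 + 2 * \sum_j a j 0)) => -[[|k] i].
  rewrite /V /= mxE normr0 mulr_ge0 ?exprn_ge0 // addr_ge0 // mulr_ge0 //.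
  by apply: sumr_ge0 => j _.
rewrite ger0_norm ?V_ge0 // VE /=.
have ai : a i 0 <= \sum_j a j 0.
  by rewrite (bigD1 i) //= lerDl; apply: sumr_ge0 => j _.
have k1 : 1 <= k.+1%:R :> R by rewrite ler1n.
have -> : k.+2%:R = k.+1%:R + 1 :> R by rewrite natr1.
have := a_ge0 i; move: (\sum_j a j 0) (a i 0) (k.+1%:R : R) ai k1 => A x K xA K1 x0.
have A0 : 0 <= A by lra.
have h1 : K * x <= K * A by rewrite ler_wpM2l //; lra.
have h2 : 0 <= A * K by rewrite mulr_ge0 //; lra.
have h3 : 0 <= A * K * K by rewrite mulr_ge0 //; lra.
nra.
Qed.

Let drift_ex : exists2 b, 0 <= b & forall s x,
  psum (fun t => mg1_matrix Q s t * V t) @ \oo --> x -> x + g s <= V s + b.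
Proof.
pose lim s := limn (psum (fun t => mg1_matrix Q s t * V t)).
have lim_ge0 s : 0 <= lim s.
  apply: limr_ge; first exact: V_cvg.
  near=> n; apply: psum_ge0 => t.
  by rewrite mulr_ge0.
exists (\sum_i `|c2 i 0| + psum (fun s => lim s + g s) 2).
  by apply: addr_ge0; [exact: sumr_ge0 | apply: psum_ge0 => s; rewrite addr_ge0].
have p2 : 0 <= psum (fun s : S => lim s + g s) 2.
  by apply: psum_ge0 => s; rewrite addr_ge0.
have c20 : 0 <= \sum_i `|c2 i 0| by exact: sumr_ge0.
move=> s x sx; have [s2|] := ltnP (tag s) 2.
  have -> : x = lim s by apply/esym/cvg_lim.
  have : lim s + g s <= psum (fun s => lim s + g s) 2.
    by apply: (@psum_term_le _ _ _ (fun s => lim s + g s)) => // t; rewrite addr_ge0.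
  by have := V_ge0 s; lra.
case: s sx => [[|[|k]] i] //= sx _.
have -> : x = V (st k.+2 i) + 2 * sigma * k.+2%:R + c2 i 0.
  by apply: (cvg_unique _ sx) => //; exact: V_row.
have : c2 i 0 <= \sum_i `|c2 i 0|.
  rewrite (bigD1 i) //= (le_trans (ler_norm _)) // lerDl; exact: sumr_ge0.
move=> cle; have gE : 2 * sigma * k.+2%:R + g (st k.+2 i) = 0.
  by rewrite /g /=; ring.
have -> : V (st k.+2 i) + 2 * sigma * k.+2%:R + c2 i 0 + g (st k.+2 i) =
    V (st k.+2 i) + c2 i 0 by rewrite -[RHS]addr0 -gE; ring.
rewrite (lerD2l (V (st k.+2 i))); apply: le_trans cle _.
by rewrite lerDl.
Unshelve. all: by end_near. Qed.

(** The quadratic Lyapunov function [V] serves for the chain and for all its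
    truncations, since truncation moves mass to lower levels. *)
Lemma uniform_mean_level : exists b : R,
  (forall p, stationary (mg1_matrix Q) p ->
     forall n, psum (fun s => p s * (tag s)%:R) n <= b) /\
  (forall N p, (0 < N)%N -> stationary (mg1_matrix (LI_blocks Q N)) p ->
     forall n, psum (fun s => p s * (tag s)%:R) n <= b).
Proof.
have [b b0 bP] := drift_ex.
have scale (p : S -> R) n : psum (fun s => p s * g s) n <= b ->
    psum (fun s => p s * (tag s)%:R) n <= b / (- 2 * sigma).
  have -> : psum (fun s => p s * g s) n =
      (- 2 * sigma) * psum (fun s => p s * (tag s)%:R) n.
    by rewrite -psumZ; apply: eq_psum => s; rewrite /g; ring.
  by rewrite ler_pdivlMr // mulrC.
exists (b / (- 2 * sigma)); split.
  move=> p hp n; apply: scale; apply: (drift_bound hP hp b0 V_ge0) => // s m.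
  have := bP s _ (@V_cvg s); apply: le_trans; rewrite lerD2r.
  by apply: psum_le_lim (@V_cvg s) => t; rewrite mulr_ge0.
move=> N p N0 hp n; have hN := LI_stochastic hP N0; apply: scale.
apply: (drift_bound hN hp b0 V_ge0) => // -[k i] m.
have [y Vy d] := LI_row hP N0 (@V_cvg (st k i)).
have := bP _ _ (@V_cvg (st k i)); apply: le_trans; rewrite lerD2r.
apply: (@le_trans _ _ y).
  by apply: psum_le_lim Vy => t; rewrite mulr_ge0 //; case: hN.
rewrite -subr_ge0; apply: (cvgr_to_ge d); near=> q.
rewrite big_nat; apply: sumr_ge0 => l /= Nl; apply: sumr_ge0 => j _.
apply: mulr_ge0; first exact: jump_ge0.
rewrite subr_ge0 !mxE !mulr1.
have kl : (k + N.-1).+1%:R <= (k + l).+1%:R :> R by rewrite ler_nat; lia.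
have k1 : 1 <= (k + N.-1).+1%:R :> R by rewrite ler1n.
have := a_ge0 j; nra.
Unshelve. all: by end_near. Qed.

End Drift.

Unset Implicit Arguments.
Set Strict Implicit.

(** * The matrix G: stochasticity and convergence of its powers *)

Section GMatrix.
Context {R : realType} {M0 M1 : nat}.
Variable Q : mg1_blocks R M0 M1.
Hypothesis hP : stochastic (mg1_matrix Q).
Hypothesis jump_sq_cvg : forall k i j,
  cvgn (fun n => \sum_(0 <= m < n) m.+1%:R ^+ 2 * jump Q k m.+1 i j).
Hypothesis hA : irreducible_mx (sumA Q) /\ stochastic_mx (sumA Q).

Local Notation T0 := (mx_sum 0 (blkA Q)).
Local Notation e := (const_mx 1 : 'cV[R]_M1).
Implicit Types (H : 'M[R]_M1) (y : 'cV[R]_M1).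

Let A0 m i j : 0 <= blkA Q m i j. Proof. exact: blkA_ge0. Qed.
Let Am0 i j : 0 <= blkAm1 Q i j. Proof. exact: blkAm1_ge0. Qed.

Let T0_cvg i j : \sum_(0 <= m < n) blkA Q m i j @[n --> \oo] --> T0 i j.
Proof. by apply: cvg_mx_sum; exact: A_summable. Qed.

Lemma A_partial_row n i :
  \sum_j blkAm1 Q i j + \sum_(0 <= m < n) \sum_j blkA Q m i j <= 1.
Proof.
have [_ A1] := (stochastic_mxP (sumA Q)).1 hA.2.
rewrite -(A1 i) exchange_big -big_split /=; apply: ler_sum => j _.
by rewrite mxE lerD2l; apply: nonneg_sum_le.
Qed.

Definition substochastic H :=
  (forall i j, 0 <= H i j) /\ (forall i, \sum_j H i j <= 1).

Lemma substochasticX H k : substochastic H -> substochastic (H ^+ k).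
Proof.
case=> H0 H1; split; first exact: expmx_ge0.
elim: k => [|k IH] i.
  rewrite (bigD1 i) //= big1 ?addr0; first by rewrite expr0 mxE eqxx.
  by move=> j ji; rewrite expr0 mxE eq_sym (negbTE ji).
apply: le_trans (H1 i); rewrite exprS.
under eq_bigr do rewrite mxE; rewrite exchange_big /=; apply: ler_sum => l _.
by rewrite -mulr_sumr ler_piMr.
Qed.

Lemma ler_expmx H H' : (forall i j, 0 <= H i j) -> mxle H H' ->
  forall k, mxle (H ^+ k) (H' ^+ k).
Proof.
move=> H0 HH'; elim=> [|k IH] i j; first by rewrite !expr0.
rewrite !exprS !mxE; apply: ler_sum => l _.
by apply: ler_pM => //; exact: expmx_ge0.
Qed.

(** [Phi] is the power series whose minimal fixed point is [G]. *)
Let Phin n H : 'M[R]_M1 :=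
  blkAm1 Q + \sum_(0 <= m < n) blkA Q m *m H ^+ m.+1.
Let Phi H : 'M[R]_M1 :=
  blkAm1 Q + mx_sum 0 (fun m => blkA Q m *m H ^+ m.+1).

Let term_ge0 H m i j : (forall i j, 0 <= H i j) ->
  0 <= (blkA Q m *m H ^+ m.+1) i j.
Proof.
by move=> H0; rewrite mxE; apply: sumr_ge0 => l _; rewrite mulr_ge0 // expmx_ge0.
Qed.

Let Phi_cvg H i j : substochastic H -> Phin n H i j @[n --> \oo] --> Phi H i j.
Proof.
move=> subH; have H0 := subH.1.
suff Hs : mx_summable 0 (fun m => blkA Q m *m H ^+ m.+1).
  rewrite /Phi /Phin mxE; under eq_fun do rewrite mxE summxE.
  by apply: cvgD; [exact: cvg_cst | exact: cvg_mx_sum].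
apply/mx_summableP => {}i {}j; apply: nonneg_sum_cvg (1 : R) _ _ => n.
  exact: term_ge0.
apply: le_trans (A_partial_row n i); rewrite ler_wpDl //.
  by apply: sumr_ge0.
apply: ler_sum => m _; rewrite mxE; apply: ler_sum => l _.
rewrite ler_piMr //; have [X0 X1] := substochasticX H m.+1 subH.
by apply: le_trans (X1 l); rewrite (bigD1 j) //= lerDl; apply: sumr_ge0.
Qed.

Let Phin_le H n : substochastic H -> mxle (Phin n H) (Phi H).
Proof.
move=> subH i j; rewrite -(cvg_lim _ (Phi_cvg H i j subH)) //.
apply: nondecreasing_cvgn_le (cvgP _ (Phi_cvg H i j subH)) _.
apply/nondecreasing_seqP => m; rewrite /Phin big_nat_recr //= addrA.
by rewrite [leRHS]mxE lerDl term_ge0 //; case: subH.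
Qed.

Let Phi_sub H : substochastic H -> substochastic (Phi H).
Proof.
move=> subH; split=> [i j|i].
  apply: le_trans (Phin_le H 0 subH i j).
  by rewrite /Phin big_geq // addr0.
have : (\sum_j Phin n H i j) @[n --> \oo] --> \sum_j Phi H i j.
  by apply: cvg_finsum => j; exact: Phi_cvg.
move/cvg_le_bound; apply; near=> n; apply: le_trans (A_partial_row n i).
rewrite /Phin; under eq_bigr do rewrite mxE summxE.
rewrite big_split /= lerD2l exchange_big /=; apply: ler_sum => m _.
under eq_bigr do rewrite mxE; rewrite exchange_big /=; apply: ler_sum => l _.
rewrite -mulr_sumr ler_piMr //.
by have [_] := substochasticX H m.+1 subH; exact.
Unshelve. all: by end_near. Qed.

Let Phi_le H H' : substochastic H -> substochastic H' -> mxle H H' ->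
  mxle (Phi H) (Phi H').
Proof.
move=> subH subH' HH' i j.
apply: ler_cvg_to (Phi_cvg H i j subH) (Phi_cvg H' i j subH') _; near=> n.
rewrite !mxE lerD2l !summxE; apply: ler_sum => m _; rewrite !mxE.
apply: ler_sum => l _; rewrite ler_wpM2l //; apply: ler_expmx => //.
by case: subH.
Unshelve. all: by end_near. Qed.

Let Gn n : 'M[R]_M1 := iter n Phi 0.

Let Gn_sub n : substochastic (Gn n).
Proof.
elim: n => [|n IH]; last exact: Phi_sub.
split=> [i j|i]; first by rewrite mxE.
by rewrite big1 ?ler01 // => j _; rewrite mxE.
Qed.

Let Gn_le n : mxle (Gn n) (Gn n.+1).
Proof.
elim: n => [|n IH]; last exact: (@Phi_le (Gn n) (Gn n.+1) (Gn_sub n) (Gn_sub n.+1) IH).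
by move=> i j; rewrite mxE; case: (Gn_sub 1).
Qed.

Let Glim : 'M[R]_M1 := \matrix_(i, j) limn (fun n => Gn n i j).

Let Glim_cvg i j : Gn n i j @[n --> \oo] --> Glim i j.
Proof.
rewrite mxE; apply: nondecreasing_is_cvgn.
  by apply/nondecreasing_seqP => n; exact: Gn_le.
exists 1 => _ [n _ <-]; have [G0 G1] := Gn_sub n.
by apply: le_trans (G1 i); rewrite (bigD1 j) //= lerDl; apply: sumr_ge0.
Qed.

Let Gn_leGlim n : mxle (Gn n) Glim.
Proof.
move=> i j; rewrite mxE; apply: nondecreasing_cvgn_le; last first.
  exact: cvgP _ (Glim_cvg i j).
by apply/nondecreasing_seqP => m; exact: Gn_le.
Qed.

Let Glim_sub : substochastic Glim.
Proof.
split=> [i j|i].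
  by apply: le_trans (Gn_leGlim 0 i j); case: (Gn_sub 0).
have : (\sum_j Gn n i j) @[n --> \oo] --> \sum_j Glim i j.
  by apply: cvg_finsum => j; exact: Glim_cvg.
by move/cvg_le_bound; apply; near=> n; case: (Gn_sub n).
Unshelve. all: by end_near. Qed.

Let GnX_cvg k i j : (Gn n ^+ k) i j @[n --> \oo] --> (Glim ^+ k) i j.
Proof.
elim: k i j => [|k IH] i j.
  by under eq_fun do rewrite expr0; exact: cvg_cst.
rewrite exprS mxE; under eq_fun do rewrite exprS mxE.
by apply: cvg_finsum => l; apply: cvgM; [exact: Glim_cvg | exact: IH].
Qed.

Let Glim_fixed : Phi Glim = Glim.
Proof.
apply/matrixP => i j; apply/le_anti/andP; split; last first.
  have : Gn n.+1 i j @[n --> \oo] --> Glim i j.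
    by have := Glim_cvg i j; rewrite -cvg_shiftS.
  move/cvg_le_bound; apply; near=> n; apply: Phi_le => //.
apply: (cvg_le_bound (Phi_cvg Glim i j Glim_sub)); near=> n.
have : Phin n (Gn k) i j @[k --> \oo] --> Phin n Glim i j.
  rewrite /Phin mxE summxE; under eq_fun do rewrite mxE summxE.
  apply: cvgD; first exact: cvg_cst.
  have := @cvg_finsum R 'I_n (fun m k => (blkA Q m *m Gn k ^+ m.+1) i j)
    (fun m => (blkA Q m *m Glim ^+ m.+1) i j).
  rewrite big_mkord; under [X in _ -> X @ _ --> _]eq_fun do rewrite big_mkord.
  apply=> m; rewrite mxE; under eq_fun do rewrite mxE.
  by apply: cvg_finsum => l; apply: cvgM; [exact: cvg_cst | exact: GnX_cvg].
move/cvg_le_bound; apply; near=> k.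
exact: le_trans (Phin_le (Gn k) n (Gn_sub k) i j) (Gn_leGlim k.+1 i j).
Unshelve. all: by end_near. Qed.

Variable G : 'M[R]_M1.
Hypothesis hG : G_minimal Q G.

Let G0 i j : 0 <= G i j.
Proof. by case: hG => -[/(_ i j) + _] _; rewrite mxE. Qed.

(** The monotone iteration from [0] yields a substochastic solution, which
    dominates the minimal one. *)
Lemma G_substochastic : substochastic G.
Proof.
have GGlim : mxle G Glim.
  apply: hG.2; split.
    by move=> i j; rewrite mxE; case: Glim_sub.
  apply/cvg_mxP => i j; rewrite -{2}Glim_fixed; exact: Phi_cvg.
split=> // i; case: Glim_sub => _ /(_ i); apply: le_trans.
by apply: ler_sum => j _; exact: GGlim.
Qed.

(** Multiplying the fixed-point equation of [G] on the right by [G ^+ n *m y]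
    shows that [n |-> G ^+ n *m y] is harmonic away from the boundary. *)
Lemma G_harmonic n y :
  \sum_(0 <= m < N) blkA Q m *m (G ^+ (n.+1 + m) *m y) @[N --> \oo] -->
  G ^+ n.+1 *m y - blkAm1 Q *m (G ^+ n *m y).
Proof.
have Gc := cvg_mulmxl (V := G ^+ n *m y) hG.1.2.
apply/cvg_mxP => i j; move/cvg_mxP: Gc => /(_ i j) Gc.
have Bc : (fun N : nat => (blkAm1 Q *m (G ^+ n *m y)) i j) @ \oo -->
    (blkAm1 Q *m (G ^+ n *m y)) i j by exact: cvg_cst.
have := cvg_seqB Gc Bc.
have -> : G *m (G ^+ n *m y) = G ^+ n.+1 *m y by rewrite mulmxA exprS.
have -> : (G ^+ n.+1 *m y) i j - (blkAm1 Q *m (G ^+ n *m y)) i j =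
    (G ^+ n.+1 *m y - blkAm1 Q *m (G ^+ n *m y)) i j.
  by rewrite [RHS]mxE [X in _ = _ + X]mxE.
apply: cvg_trans; apply: near_eq_cvg; near=> N.
rewrite mulmxDl mxE addrAC subrr add0r mulmx_suml.
congr ((_ : 'cV[R]_M1) i j); apply: eq_bigr => m _.
by rewrite -mulmxA [G ^+ m.+1 *m _]mulmxA -[X in _ *m (X *m _)]exprD addSnnS addnC.
Unshelve. all: by end_near. Qed.

Lemma G_term_le n y m i l : (forall k, 0 <= y k 0) ->
  blkA Q m i l * (G ^+ (n.+1 + m) *m y) l 0 <= (G ^+ n.+1 *m y) i 0 /\
  blkAm1 Q i l * (G ^+ n *m y) l 0 <= (G ^+ n.+1 *m y) i 0.
Proof.
move=> y0; have Gy0 k j : 0 <= (G ^+ k *m y) j 0.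
  by rewrite mxE; apply: sumr_ge0 => b _; rewrite mulr_ge0 // expmx_ge0.
have AG0 q b : 0 <= (blkA Q q *m (G ^+ (n.+1 + q) *m y)) b 0.
  by rewrite mxE; apply: sumr_ge0 => c _; rewrite mulr_ge0.
have /cvg_mxP/(_ i 0) h := G_harmonic n y.
have {}h : \sum_(0 <= q < N) (blkA Q q *m (G ^+ (n.+1 + q) *m y)) i 0
   @[N --> \oo] --> (G ^+ n.+1 *m y) i 0 - (blkAm1 Q *m (G ^+ n *m y)) i 0.
  move: h; rewrite [X in _ --> X -> _]mxE [X in _ --> _ + X -> _]mxE.
  by under eq_fun do rewrite summxE.
have Am : blkAm1 Q i l * (G ^+ n *m y) l 0 <= (blkAm1 Q *m (G ^+ n *m y)) i 0.
  rewrite [leRHS]mxE (bigD1 l) //= lerDl.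
  by apply: sumr_ge0 => c _; rewrite mulr_ge0.
have A : blkA Q m i l * (G ^+ (n.+1 + m) *m y) l 0 <=
    (blkA Q m *m (G ^+ (n.+1 + m) *m y)) i 0.
  rewrite [leRHS]mxE (bigD1 l) //= lerDl.
  by apply: sumr_ge0 => c _; rewrite mulr_ge0.
have := nonneg_sum_le m.+1 (fun q => AG0 q i) h.
rewrite big_nat_recr //=.
have : 0 <= \sum_(0 <= q < m) (blkA Q q *m (G ^+ (n.+1 + q) *m y)) i 0.
  by apply: sumr_ge0.
have Am' : 0 <= (blkAm1 Q *m (G ^+ n *m y)) i 0.
  by rewrite mxE; apply: sumr_ge0 => c _; rewrite mulr_ge0.
have := AG0 m i.
by move=> h1 h2 h3; split; lra.
Qed.

Variables (varpi : 'rV[R]_M1) (a : 'cV[R]_M1).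
Hypothesis a_ge0 : forall i, 0 <= a i 0.
Hypothesis aE : sumA Q *m a + meanA Q = a + drift Q varpi *: e.
Hypothesis sigma_lt0 : drift Q varpi < 0.

(** Under negative drift the bounded function [n |-> e - G ^+ n *m e] vanishes:
    minus a small multiple of [n + a], which has negative drift, it would
    otherwise attain a positive maximum off the boundary. *)
Lemma G_stochastic : stochastic_mx G.
Proof.
have [_ G1] := G_substochastic.
apply/stochastic_mxP; split=> // i0; apply/le_anti; rewrite G1 /=.
suff small : forall eps, 0 < eps -> 1 - \sum_j G i0 j <= eps.
  rewrite -subr_le0; apply/ler_addgt0Pr => eps eps0; rewrite add0r.
  exact: small.
suff key : forall eps, 0 < eps ->
    forall n i, 1 - (G ^+ n *m e) i 0 - eps * (n%:R + a i 0) <= 0.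
  move=> eps eps0; pose d := eps / (1 + a i0 0).
  have a1 : 0 < 1 + a i0 0 by have := a_ge0 i0; lra.
  have := key d (divr_gt0 eps0 a1) 1%N i0; rewrite expr1 mxE.
  under eq_bigr do rewrite mxE mulr1; rewrite /d divfK ?gt_eqF //; lra.
move=> {i0} eps eps0; pose d n : 'cV[R]_M1 :=
  - eps *: ((1 - eps^-1 + (n%:R - 1)) *: e + a) - G ^+ n *m e.
have dE n i : d n i 0 = 1 - (G ^+ n *m e) i 0 - eps * (n%:R + a i 0).
  rewrite /d mxE [X in _ + X]mxE; move: (G ^+ n *m e) => w.
  rewrite !mxE; field; exact: lt0r_neq0.
have Ge0 n i : 0 <= (G ^+ n *m e) i 0.
  by rewrite mxE; apply: sumr_ge0 => b _; rewrite !mxE mulr1 expmx_ge0.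
have d0 i : d 0%N i 0 <= 0.
  rewrite dE expr0 mul1mx mxE add0r subrr sub0r oppr_le0 mulr_ge0 //; lra.
suff H : forall n i, d n i 0 <= 0 by move=> n i; rewrite -dE.
move=> n i.
have d_cvg k : \sum_(0 <= m < N) blkA Q m *m d (k.+1 + m)%N @[N --> \oo] -->
    d k.+1 - (eps * drift Q varpi) *: e - blkAm1 Q *m d k.
  have := @A_linear_cvg _ _ _ _ hP jump_sq_cvg _ hA _ aE (1 - eps^-1) k.
  have := G_harmonic k e.
  move=> /cvg_mxP h1 /cvg_mxP h2; apply/cvg_mxP => b c.
  have := cvg_seqB (@cvg_seqZ _ (- eps) _ _ (h2 b c)) (h1 b c).
  have -> : - eps * ((1 - eps^-1 + k%:R) *: e + a + drift Q varpi *: e -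
      blkAm1 Q *m ((1 - eps^-1 + k%:R - 1) *: e + a)) b c -
      (G ^+ k.+1 *m e - blkAm1 Q *m (G ^+ k *m e)) b c =
      (d k.+1 - (eps * drift Q varpi) *: e - blkAm1 Q *m d k) b c.
    rewrite /d mulmxBr -!scalemxAr !mulmxDr -!scalemxAr.
    move: (G ^+ k *m e) (G ^+ k.+1 *m e) (blkAm1 Q *m e) (blkAm1 Q *m a).
    move=> u v w x; move: (blkAm1 Q *m u) (drift Q varpi) => z s.
    by rewrite !mxE -(natr1 k); ring.
  apply: cvg_trans; apply: near_eq_cvg; near=> N.
  rewrite !summxE mulr_sumr -sumrB; apply: eq_bigr => m _.
  have -> : d (k.+1 + m)%N = - eps *: ((1 - eps^-1 + (k + m)%:R) *: e + a)
     - G ^+ (k.+1 + m) *m e.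
    by rewrite /d addSn -natr1; congr (- eps *: (_ *: _ + _) - _); ring.
  by rewrite mulmxBr -scalemxAr [RHS]mxE [X in _ = X + _]mxE [X in _ = _ + X]mxE.
apply: contrapT => /negP; rewrite -ltNge => dn.
(* from level [B] on, the penalty [eps * n] exceeds the bound [1] *)
pose B := (Num.truncn eps^-1).+1.
have Bbig m : (B <= m)%N -> forall b, d m b 0 <= 0.
  move=> Bm b; rewrite dE.
  have : eps^-1 <= m%:R.
    apply: ltW; apply: lt_le_trans (truncnS_gt _) _.
    by rewrite ler_nat.
  rewrite -[eps^-1]mul1r ler_pdivrMr // => m1.
  have := Ge0 m b; have := a_ge0 b; nra.
have nB : (n < B)%N by rewrite ltnNge; apply/negP => /Bbig/(_ i); lra.
pose x0 : 'I_B * 'I_M1 := (Ordinal nB, i).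
pose D (x : 'I_B * 'I_M1) := d x.1 x.2 0.
pose xm := [arg max_(x > x0) D x]%O.
have xmax x : D x <= D xm.
  by rewrite /xm; case: arg_maxP => // b _ bmax; exact: bmax.
have M0' : 0 < D xm by apply: lt_le_trans (xmax x0).
have dM m b : d m b 0 <= D xm.
  have [mB|Bm] := ltnP m B; first exact: (xmax (Ordinal mB, b)).
  by apply: le_trans (ltW M0'); exact: Bbig.
case: xm xmax M0' dM => -[[|k] kB] b; rewrite /D /= => _ dk dM.
  by have := d0 b; lra.
have /cvg_mxP/(_ b 0) := d_cvg k.
have -> : (d k.+1 - (eps * drift Q varpi) *: e - blkAm1 Q *m d k) b 0 =
    d k.+1 b 0 - eps * drift Q varpi - (blkAm1 Q *m d k) b 0.
  by move: (blkAm1 Q *m d k) (d k.+1) => u w; rewrite !mxE mulr1.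
move=> lim; have : d k.+1 b 0 - eps * drift Q varpi - (blkAm1 Q *m d k) b 0
   <= d k.+1 b 0 - (blkAm1 Q *m d k) b 0.
  apply: (cvg_le_bound lim); near=> N.
  rewrite summxE lerBrDl.
  have := A_partial_row N b => /(ler_wpM2l (ltW dk)); rewrite mulr1.
  apply: le_trans; rewrite mulrDr !mulr_sumr.
  apply: lerD.
    by rewrite mxE; apply: ler_sum => l _; rewrite mulrC ler_wpM2r.
  apply: ler_sum => m _; rewrite mxE mulr_sumr; apply: ler_sum => l _.
  by rewrite mulrC ler_wpM2r.
have : eps * drift Q varpi < 0 by rewrite pmulr_rlt0.
lra.
Unshelve. all: by end_near. Qed.

Variable C : {set 'I_M1}.
Hypothesis hC : closed_comm_class G C.
Hypothesis haper : aperiodic_class G C.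

(** [C] is the only closed class: the states from which [C] is reached by
    [G ^+ n] for all large [n] can be propagated backwards along the
    transitions of the irreducible matrix [sumA Q]. *)
Lemma G_reaches_class i : exists2 j, j \in C & accessible G i j.
Proof.
have Gs := G_stochastic; have [C0 _ Ccl] := hC.
pose v : 'cV[R]_M1 := \col_k (k \in C)%:R.
have v0 k : 0 <= v k 0 by rewrite mxE ler0n.
pose X k := exists n0, forall n, (n0 <= n)%N -> 0 < (G ^+ n *m v) k 0.
have [j jC] := set0Pn _ C0.
have Xj : X j.
  exists 0%N => n _; have /stochastic_mxP[Gn0 Gn1] := expmx_stochastic n Gs.
  have [l jl] : exists l, 0 < (G ^+ n) j l.
    apply: contrapT => /forallNP np.
    have : \sum_l (G ^+ n) j l = 0.
      apply: big1 => l _; apply/le_anti; rewrite Gn0 andbT leNgt.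
      by apply/negP; exact: np.
    by rewrite Gn1 => /eqP; rewrite oner_eq0.
  have lC : l \in C by apply: Ccl jC _; exists n.
  rewrite mxE (bigD1 l) //= !mxE lC mulr1 ltr_pwDl //.
  by apply: sumr_ge0 => k _; rewrite mulr_ge0.
have Xback k l : 0 < sumA Q k l -> X l -> X k.
  move=> kl [n0 Xl]; exists n0.+1 => -[//|n] n0n.
  have [Akl|Akl] := ltP 0 (blkAm1 Q k l).
    have [_] := G_term_le n v 0 k l v0.
    by apply: lt_le_trans; rewrite mulr_gt0 // Xl.
  have [m Am] : exists m, 0 < blkA Q m k l.
    apply: contrapT => /forallNP np; move: kl; rewrite mxE.
    suff -> : T0 k l = 0 by rewrite addr0 ltNge Akl.
    apply: (cvg_unique _ (T0_cvg k l)) => //.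
    have -> : (fun n => \sum_(0 <= m < n) blkA Q m k l) = fun=> 0.
      apply/funext => q; apply: big1 => m _; apply/le_anti.
      by rewrite A0 andbT leNgt; apply/negP; exact: np.
    exact: cvg_cst.
  have [+ _] := G_term_le n v m k l v0.
  apply: lt_le_trans; rewrite mulr_gt0 // Xl //.
  by rewrite (leq_trans _ (leq_addr _ _)) // ltnW.
have Xi : X i.
  apply: contrapT => nXi.
  have [sA0 _] := (stochastic_mxP (sumA Q)).1 hA.2.
  apply: (@irreducible_mx_closed _ _ (sumA Q) (fun k => ~ X k) i sA0 hA.1 _ nXi j) => //.
  by move=> k l nXk kl Xl; apply: nXk; exact: Xback Xl.
have [n0 /(_ n0 (leqnn n0))] := Xi; rewrite mxE => pos.
apply: contrapT => nreach; move: pos; rewrite big1 ?ltxx // => l _.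
have -> : v l 0 = (l \in C)%:R by rewrite mxE.
case: (boolP (l \in C)) => lC; rewrite ?mulr0 //.
have [il|il] := ltP 0 ((G ^+ n0) i l).
  by exfalso; apply: nreach; exists l => //; exists n0.
by rewrite mulr1; apply/le_anti; rewrite il expmx_ge0.
Qed.

(** Aperiodicity of the class excludes oscillations of [G ^+ m *m y]. *)
Lemma G_increment_cvg0 y i :
  (G ^+ m.+1 *m y - G ^+ m *m y) i 0 @[m --> \oo] --> (0 : R).
Proof.
have [n0 [j [eps [eps0 Gj]]]] :=
  aperiodic_doeblin G_stochastic hC haper G_reaches_class.
exact: (doeblin_increment_cvg0 y G_stochastic eps0 Gj).
Qed.

End GMatrix.

(** * The Poisson equation *)

Section Poisson.
Context {R : realType} {M0 M1 : nat}.
Local Notation S := (mg1_state M0 M1).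
Local Notation st k i := (existT (fun l => 'I_(level_size M0 M1 l)) k i : S).
Local Notation e := (const_mx 1 : 'cV[R]_M1).
Variable Q : mg1_blocks R M0 M1.
Hypothesis hP : stochastic (mg1_matrix Q).
Hypothesis jump_sq_cvg : forall k i j,
  cvgn (fun n => \sum_(0 <= m < n) m.+1%:R ^+ 2 * jump Q k m.+1 i j).
Hypothesis hirr : irreducible (mg1_matrix Q).
Hypothesis hA : irreducible_mx (sumA Q) /\ stochastic_mx (sumA Q).
Variable p : S -> R.
Hypothesis hp : stationary (mg1_matrix Q) p.
Variables (varpi : 'rV[R]_M1) (a : 'cV[R]_M1).
Local Notation sigma := (drift Q varpi).
Hypothesis a_ge0 : forall i, 0 <= a i 0.
Hypothesis aE : sumA Q *m a + meanA Q = a + sigma *: e.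
Hypothesis sigma_lt0 : sigma < 0.
Variable G : 'M[R]_M1.
Hypothesis Gs : stochastic_mx G.
Hypothesis hG : G_minimal Q G.
Hypothesis G_incr : forall (y : 'cV[R]_M1) i,
  (G ^+ m.+1 *m y - G ^+ m *m y) i 0 @[m --> \oo] --> (0 : R).

Let P0 s t : 0 <= mg1_matrix Q s t. Proof. by case: hP. Qed.
Let p0 s : 0 <= p s. Proof. by case: hp. Qed.

Definition linear_growth (c : R) (h : S -> R) :=
  forall s, `|h s| <= c * (tag s).+1%:R.

Let act (h : S -> R) s := limn (psum (fun t => mg1_matrix Q s t * h t)).

Lemma linear_growth_row_cvg c h s : linear_growth c h ->
  cvgn (psum (fun t => mg1_matrix Q s t * h t)).
Proof.
move=> hc; apply: (@quadratic_row_cvg _ _ _ Q hP jump_sq_cvg h c) => t.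
apply: le_trans (hc t) _.
have c0 : 0 <= c.
  by have := le_trans (normr_ge0 _) (hc t); rewrite pmulr_lge0.
by rewrite ler_wpM2l // expr2 ler_peMl // ler1n.
Qed.

Lemma linear_growth_law_cvg c (b : R) (q : S -> R) : (forall s, 0 <= q s) ->
  psum q @ \oo --> (1 : R) ->
  (forall n, psum (fun s => q s * (tag s)%:R) n <= b) ->
  cvgn (psum (fun s => q s * (c * (tag s).+1%:R))).
Proof.
move=> q0 q1 qb.
have /cvg_ex[x qx] : cvgn (psum (fun s => q s * (tag s)%:R)).
  by apply: psum_bounded_cvg qb => s; rewrite mulr_ge0.
have := @cvg_seqZ _ c _ _ (cvg_seqD qx q1).
move=> h; apply: (@cvgP _ _ (c * (x + 1))); move: h.
apply: cvg_trans; apply: near_eq_cvg; near=> n.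
rewrite -psumD -psumZ; apply: eq_psum => s; rewrite -natr1; ring.
Unshelve. all: by end_near. Qed.

(** The mean level being finite, functions of linear growth are integrable. *)
Lemma linear_growth_increment c h q :
  linear_growth c h ->
  (forall s, psum (fun t => mg1_matrix Q s t * h t) @ \oo --> h s + q s) ->
  psum (fun s => p s * q s) @ \oo --> (0 : R).
Proof.
move=> hc hq; pose g (s : S) := c * (tag s).+1%:R.
have gc : linear_growth `|c| g.
  by move=> s; rewrite normrM (ger0_norm (x := _%:R)).
have [b [pb _]] := uniform_mean_level hP jump_sq_cvg hA a_ge0 aE sigma_lt0.
have gP s : psum (fun t => mg1_matrix Q s t * g t) @ \oo --> act g s.
  exact: linear_growth_row_cvg gc.
have /cvg_ex[x gx] := linear_growth_law_cvg c b p p0 (law_sum1 hp) (pb p hp).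
exact: (stationary_increment hP hp hc gP gx).
Qed.

Section Extension.
Variable K : nat.

Local Notation boundary := ('I_M0 + 'I_K.+1 * 'I_M1)%type.

Definition boundary_state (t : boundary) : S :=
  match t with inl i => st 0 i | inr (l, i) => st l.+1 i end.

Definition top_values (x : boundary -> R) : 'cV[R]_M1 :=
  \col_i x (inr (inord K, i)).

(** Above level [K.+1] a solution of the Poisson equation with right-hand side
    [c] is a particular solution, affine in the level with slope [c / sigma],
    plus a bounded harmonic function [G ^+ m *m z]; [z] is fixed by continuity
    at level [K.+1]. The unknowns left are the boundary values [x] and [c]. *)
Definition extend (x : boundary -> R) (c : R) : S -> R :=
  by_level (\col_i x (inl i)) (fun l =>
    if (l < K)%N then \col_i x (inr (inord l, i)) else
    G ^+ (l - K) *m (top_values x - (c / sigma) *: a)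
    + (c / sigma) *: ((l - K)%:R *: e + a)).

Lemma extend_boundary x c t : extend x c (boundary_state t) = x t.
Proof.
case: t => [i|[l i]] /=; first by rewrite mxE.
case: ltnP => lK; first by rewrite mxE inord_val.
have lE : l = inord K by apply/val_inj; rewrite /= inordK //; have := ltn_ord l; lia.
rewrite lE inordK // subnn expr0 mul1mx scale0r add0r subrK mxE.
by [].
Qed.

Lemma state_cases s : (exists t, s = boundary_state t) \/
  exists k i, s = st (k + K).+2 i.
Proof.
case: s => [[|l] i]; first by left; exists (inl i).
have [lK|Kl] := leqP l K.
  by left; exists (inr (inord l, i)); rewrite /= inordK.
right; move: i; have -> : l = (l - K.+1 + K).+1 by lia.
by move=> i; exists (l - K.+1)%N, i.
Qed.

Lemma extend_linear (b c d : R) x y s :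
  extend (fun t => b * x t + y t) (b * c + d) s =
  b * extend x c s + extend y d s.
Proof.
case: s => [[|l] i]; rewrite /extend /by_level; first by rewrite !mxE.
case: ifP => _; first by rewrite !mxE.
have -> : top_values (fun t => b * x t + y t) =
    b *: top_values x + top_values y by apply/colP => j; rewrite !mxE.
rewrite mulrDl !mulmxBr mulmxDr -!scalemxAr.
move: (G ^+ (l - K) *m top_values x) (G ^+ (l - K) *m top_values y).
by move: (G ^+ (l - K) *m a) => u v w; rewrite !mxE; ring.
Qed.

Lemma G_bounded (z : 'cV[R]_M1) n i : `|(G ^+ n *m z) i 0| <= \sum_j `|z j 0|.
Proof.
rewrite ler_norml; apply: stochastic_bounds; first exact: expmx_stochastic.
move=> j; rewrite -ler_norml (bigD1 j) //= lerDl; exact: sumr_ge0.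
Qed.

Lemma extend_growth x c : exists d, linear_growth d (extend x c).
Proof.
pose z := top_values x - (c / sigma) *: a.
pose X := \sum_t `|x t|; pose Z := \sum_j `|z j 0|.
pose Y := `|c / sigma| * (1 + \sum_j a j 0).
have X0 : 0 <= X by apply: sumr_ge0.
have Z0 : 0 <= Z by apply: sumr_ge0.
have A0 : 0 <= \sum_j a j 0 by apply: sumr_ge0.
have Y0 : 0 <= Y by rewrite mulr_ge0 // addr_ge0.
exists (X + Z + Y).
have bx t : `|x t| <= X by rewrite /X (bigD1 t) //= lerDl; apply: sumr_ge0.
have bX (t : boundary) k : `|x t| <= (X + Z + Y) * k.+1%:R.
  apply: le_trans (bx t) _; apply: (@le_trans _ _ (X + Z + Y)); first lra.
  by rewrite ler_peMr ?ler1n //; lra.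
case=> [[|l] i]; rewrite /extend /by_level; first by rewrite mxE.
case: ifP => _; first by rewrite mxE.
have Gz := G_bounded z (l - K) i.
rewrite mxE; apply: le_trans (ler_normD _ _) _.
have -> : ((c / sigma) *: ((l - K)%:R *: e + a)) i 0 =
   (c / sigma) * ((l - K)%:R + a i 0) by rewrite !mxE mulr1.
have l1 : 1 <= l.+2%:R :> R by rewrite ler1n.
have h2 : `|c / sigma * ((l - K)%:R + a i 0)| <= Y * l.+2%:R.
  rewrite normrM /Y -mulrA ler_wpM2l // ger0_norm ?addr_ge0 //.
  have : (l - K)%:R <= l.+2%:R :> R by rewrite ler_nat; lia.
  have : a i 0 <= \sum_j a j 0 by rewrite (bigD1 i) //= lerDl; apply: sumr_ge0.
  move: (l - K)%:R (a i 0) (\sum_j a j 0) l.+2%:R A0 l1 => u v w t *; nra.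
have h3 : Z <= Z * l.+2%:R by rewrite ler_peMr.
have h4 : 0 <= X * l.+2%:R by rewrite mulr_ge0.
rewrite /= !mulrDl; move: Gz; rewrite -/z -/Z => Gz; lra.
Qed.

Lemma extend_interior x c k i :
  psum (fun t => mg1_matrix Q (st (k + K).+2 i) t * extend x c t) @ \oo -->
  extend x c (st (k + K).+2 i) + c.
Proof.
pose z := top_values x - (c / sigma) *: a.
pose u l := G ^+ (l - K) *m z + (c / sigma) *: ((l - K)%:R *: e + a).
pose v l := if (l < K)%N then \col_i x (inr (inord l, i)) else u l.
have vu l : (K <= l)%N -> v l = u l by rewrite /v leqNgt => /negbTE ->.
pose w : 'cV[R]_M1 := G ^+ k.+1 *m z - blkAm1 Q *m (G ^+ k *m z) +
  (c / sigma) *: ((1 + k%:R) *: e + a + sigma *: e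
   - blkAm1 Q *m ((1 + k%:R - 1) *: e + a)).
have vw : \sum_(0 <= m < n) blkA Q m *m v ((k + K).+1 + m)%N @[n --> \oo] --> w.
  have := @A_linear_cvg _ _ _ _ hP jump_sq_cvg _ hA _ aE 1 k.
  have := G_harmonic Q G hG k z.
  move=> /cvg_mxP h1 /cvg_mxP h2; apply/cvg_mxP => b d.
  have := cvg_seqD (h1 b d) (@cvg_seqZ _ (c / sigma) _ _ (h2 b d)).
  have -> : forall X Y : 'cV[R]_M1, X b d + (c / sigma) * Y b d =
     (X + (c / sigma) *: Y) b d by move=> X Y; rewrite !mxE.
  apply: cvg_trans; apply: near_eq_cvg; near=> n.
  rewrite !summxE mulr_sumr -big_split /=; apply: eq_bigr => m _.
  rewrite vu; last by lia.
  rewrite /u (_ : (k + K).+1 + m - K = k.+1 + m)%N; last by lia.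
  rewrite mulmxDr -scalemxAr addSn -natr1 [1 + _]addrC.
  by rewrite [RHS]mxE [X in _ = _ + X]mxE.
have := psum_row_interior (i := i) (f := extend x c) (u := v) _ vw.
have -> : (blkAm1 Q *m v (k + K)%N + w) i 0 = extend x c (st (k + K).+2 i) + c.
  rewrite vu ?leq_addl // /u addnK.
  have -> : extend x c (st (k + K).+2 i) = u (k + K).+1 i 0.
    by rewrite -vu //; lia.
  rewrite /u subSn ?leq_addl // addnK /w.
  have -> : 1 + k%:R - 1 = k%:R :> R by ring.
  rewrite mulmxDr -scalemxAr -(natr1 k).
  move: (blkAm1 Q *m (k%:R *: e + a)) (blkAm1 Q *m (G ^+ k *m z)) => b1 b2.
  have -> : c = c / sigma * sigma by rewrite divfK // lt_eqF.
  rewrite [in LHS]mulfK ?lt_eqF // [in X in _ = X + _]mulfK ?lt_eqF //.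
  move: (G ^+ k.+1 *m z) (c / sigma) => g kap.
  by rewrite !mxE; ring.
by apply; move=> l j; rewrite /extend /by_level -/z.
Unshelve. all: by end_near. Qed.

Lemma extend_increment_cvg x c (i : 'I_M1) :
  extend x c (st l.+2 i) - extend x c (st l.+1 i) @[l --> \oo] --> c / sigma.
Proof.
pose z := top_values x - (c / sigma) *: a.
have kc : (fun _ : nat => c / sigma) @ \oo --> c / sigma by exact: cvg_cst.
have := cvg_seqD (G_incr z i) kc.
rewrite add0r -(cvg_shiftn K (fun l => extend x c (st l.+2 i) - _)).
apply: cvg_trans; apply: near_eq_cvg; near=> l.
rewrite /= /extend /by_level !ltnNge leqW ?leq_addl //= -/z.
rewrite subSn ?leq_addl // addnK.
move: (G ^+ l *m z) (G ^+ l.+1 *m z) => u v; rewrite !mxE -natr1; ring.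
Unshelve. all: by end_near. Qed.

(** Only the equations at the boundary states remain to be solved; they are as
    many as the values of [x], hence one fewer than the unknowns. *)
Let residual x c t :=
  extend x c (boundary_state t) - act (extend x c) (boundary_state t) + c.

Lemma extend_act x c s :
  psum (fun t => mg1_matrix Q s t * extend x c t) @ \oo --> act (extend x c) s.
Proof.
by have [d /linear_growth_row_cvg] := extend_growth x c; exact.
Qed.

Lemma residual_linear (b c d : R) x y t :
  residual (fun u => b * x u + y u) (b * c + d) t =
  b * residual x c t + residual y d t.
Proof.
rewrite /residual extend_linear.
suff -> : act (extend (fun u => b * x u + y u) (b * c + d)) (boundary_state t) =
  b * act (extend x c) (boundary_state t) + act (extend y d) (boundary_state t).
  by ring.
apply/cvg_lim => //.
have := cvg_seqD (@cvg_seqZ _ b _ _ (extend_act x c (boundary_state t)))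
  (extend_act y d (boundary_state t)).
apply: cvg_trans; apply: near_eq_cvg; near=> n.
rewrite -psumZ -psumD; apply: eq_psum => s; rewrite extend_linear; ring.
Unshelve. all: by end_near. Qed.

(** Integration against [p] gives [c = 0]; then the affine part disappears and
    the extension is a bounded harmonic function, hence constant. *)
Lemma residual_kernel x c : (forall t, residual x c t = 0) ->
  c = 0 /\ forall s t, x s = x t.
Proof.
move=> x0; have eqn s : psum (fun t => mg1_matrix Q s t * extend x c t) @ \oo
    --> extend x c s + c.
  have [[t ->]|[k [i ->]]] := state_cases s; last exact: extend_interior.
  have -> : extend x c (boundary_state t) + c =
      act (extend x c) (boundary_state t).
    by have := x0 t; rewrite /residual => /eqP; rewrite addrAC subr_eq0 => /eqP.
  exact: extend_act.
have [d dx] := extend_growth x c.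
have c0 : c = 0.
  have := linear_growth_increment d _ (fun=> c) dx eqn.
  by move=> h; apply: (cvg_unique _ (@law_cst _ _ _ _ _ hp c) h).
split=> // s t; subst c; rewrite -(extend_boundary x 0 s) -(extend_boundary x 0 t).
pose z := top_values x - (0 / sigma) *: a.
apply: (bounded_harmonic_cst hP hp hirr (c := \sum_t `|x t| + \sum_j `|z j 0|)).
  have bx u : `|x u| <= \sum_t `|x t|.
    by rewrite (bigD1 u) //= lerDl; apply: sumr_ge0.
  have X0 : 0 <= \sum_t `|x t| by apply: sumr_ge0.
  have Z0 : 0 <= \sum_j `|z j 0| by apply: sumr_ge0.
  case=> [[|l] i]; rewrite /extend /by_level.
    by rewrite mxE; have := bx (inl i); lra.
  case: ifP => _; first by rewrite mxE; have := bx (inr (inord l, i)); lra.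
  rewrite -/z mul0r scale0r addr0.
  have := G_bounded z (l - K) i; lra.
by move=> u; have := eqn u; rewrite addr0.
Qed.

Lemma boundary_poisson (b : boundary -> R) : exists x c, forall t,
  psum (fun s => mg1_matrix Q (boundary_state t) s * extend x c s) @ \oo -->
  extend x c (boundary_state t) + (c - b t).
Proof.
have [x [c xc]] := @fredholm_surj _ _ residual residual_linear residual_kernel b.
exists x, c => t; have -> : extend x c (boundary_state t) + (c - b t) =
    act (extend x c) (boundary_state t) by rewrite -xc /residual; ring.
exact: extend_act.
Qed.

End Extension.

(** The constant [c] of the Fredholm alternative is identified as [p s0] by
    integrating the equation against [p]. *)
Lemma poisson_solution (s0 : S) : exists h d, [/\ linear_growth d h,
  forall s, psum (fun t => mg1_matrix Q s t * h t) @ \oo -->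
    h s + (p s0 - (s == s0)%:R) &
  forall i : 'I_M1, h (st l.+2 i) - h (st l.+1 i) @[l --> \oo] --> p s0 / sigma].
Proof.
have [x [c xc]] := boundary_poisson (tag s0) (fun t => (boundary_state _ t == s0)%:R).
have [d dx] := extend_growth (tag s0) x c.
have eqn s : psum (fun t => mg1_matrix Q s t * extend (tag s0) x c t) @ \oo -->
    extend (tag s0) x c s + (c - (s == s0)%:R).
  have [[t ->]|[k [i sE]]] := state_cases (tag s0) s; first exact: xc.
  have -> : (s == s0) = false.
    apply/negbTE/eqP => ss0; have : tag s = (k + tag s0).+2 by rewrite sE.
    by rewrite ss0; lia.
  by rewrite subr0 sE; exact: extend_interior.
suff cE : c = p s0.
  exists (extend (tag s0) x c), d; split=> // [s|i]; first by rewrite -cE.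
  by rewrite -cE; exact: extend_increment_cvg.
have h := linear_growth_increment d _ (fun s => c - (s == s0)%:R) dx eqn.
have := cvg_seqB (@law_cst _ _ _ _ _ hp c) h; rewrite subr0 => h1.
have h2 : psum (fun s => p s * (s == s0)%:R) @ \oo --> p s0.
  apply: cvg_near_cst; near=> n.
  have n0 : (tag s0 < n)%N by near: n; exact: nbhs_infty_gt.
  exact: psum_pred1.
apply: (cvg_unique _ _ h2) => //; move: h1.
apply: cvg_trans; apply: near_eq_cvg; near=> n.
rewrite -psumB; apply: eq_psum => s; ring.
Unshelve. all: by end_near. Qed.

End Poisson.

(** * Moments of the jumps and asymptotic comparison *)

Section Moments.
Context {R : realType}.

Lemma bernoulli_ge (d : R) m : 0 <= d -> 1 + m%:R * d <= (1 + d) ^+ m.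
Proof.
move=> d0; elim: m => [|m IH]; first by rewrite expr0; lra.
rewrite exprS -natr1; have m0 : 0 <= m%:R :> R by [].
have : (1 + d) * (1 + m%:R * d) <= (1 + d) * (1 + d) ^+ m.
  by rewrite ler_wpM2l //; lra.
apply: le_trans; nra.
Qed.

(** By Bernoulli's inequality for [s = sqrt z], [k * (s - 1) <= s ^+ k], whose
    square bounds [k ^ 2] by a multiple of [z ^+ k]. *)
Lemma geometric_sq_cvg (z : R) (x : nat -> R) : 1 < z ->
  (forall m, 0 <= x m.+1) -> cvgn (fun n => \sum_(1 <= k < n) z ^+ k * x k) ->
  cvgn (fun n => \sum_(0 <= m < n) m.+1%:R ^+ 2 * x m.+1).
Proof.
move=> z1 x0 /cvg_ex[l zl].
pose s := Num.sqrt z; have s1 : 1 < s by rewrite -[ltLHS]sqrtr1 ltr_sqrt //; lra.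
have sz : s ^+ 2 = z by rewrite sqr_sqrtr //; lra.
have sq k : (k%:R * (s - 1)) ^+ 2 <= z ^+ k.
  rewrite -sz -exprM mulnC exprM ler_pXn2r ?nnegrE ?exprn_ge0 ?mulr_ge0 //; try lra.
  have := @bernoulli_ge (s - 1) k; rewrite subrKC => h.
  by have : 0 <= s - 1 by [lra]; move/h; lra.
apply: (@dom_sum_cvg _ _ (fun m => (s - 1) ^- 2 * (z ^+ m.+1 * x m.+1))) => [m|].
  rewrite ger0_norm; last by rewrite mulr_ge0 // exprn_ge0.
  rewrite mulrA ler_wpM2r // mulrC ler_pdivlMr; last by rewrite exprn_gt0 //; lra.
  by rewrite -exprMn.
have : (s - 1) ^- 2 * \sum_(1 <= k < n) z ^+ k * x k @[n --> \oo]
   --> (s - 1) ^- 2 * l by apply: cvgM => //; exact: cvg_cst.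
rewrite -cvg_shiftS => h; apply: (@cvgP _ _ ((s - 1) ^- 2 * l)); move: h.
apply: cvg_trans; apply: near_eq_cvg; near=> n.
by rewrite /= big_add1 /= mulr_sumr.
Unshelve. all: by end_near. Qed.

Lemma radius_sq_cvg (m q : nat) (X : nat -> 'M[R]_(m, q)) :
  (1%:E < Defs.radius X)%E -> (forall k i j, 0 <= X k.+1 i j) ->
  forall i j, cvgn (fun n => \sum_(0 <= k < n) k.+1%:R ^+ 2 * X k.+1 i j).
Proof.
move=> /ereal_sup_gt[_ [z [_ /mx_summableP Xs] <-]]; rewrite lte_fin => z1 X0 i j.
apply: (geometric_sq_cvg z (fun k => X k i j)) => //.
by have := Xs i j; under eq_fun do under eq_bigr do rewrite mxE.
Qed.

(** The errors are relative to [v], which is bounded since it converges. *)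
Lemma cvg_relative (u v : nat -> R) (kap w : R) : v @ \oo --> w ->
  (forall eps, 0 < eps -> \forall n \near \oo, `|u n + kap * v n| <= eps * v n) ->
  u @ \oo --> - kap * w.
Proof.
move=> vw uv; apply/cvgrPdist_lt => eps eps0.
have e1 : 0 < eps / 2 / (`|w| + 1) by rewrite !divr_gt0 // ltr_wpDl.
have vb : \forall n \near \oo, `|w - v n| < 1.
  by have /cvgrPdist_lt := vw; apply.
have ku : - kap * v n @[n --> \oo] --> - kap * w.
  by apply: cvgM => //; exact: cvg_cst.
have /cvgrPdist_lt/(_ (eps / 2)) kv := ku.
near=> n.
have h1 : `|- kap * w - - kap * v n| < eps / 2.
  by near: n; apply: kv; lra.
have h2 : `|u n + kap * v n| <= eps / 2 / (`|w| + 1) * v n by near: n; exact: uv.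
have h3 : `|w - v n| < 1 by near: n.
have h4 : v n <= `|w| + 1.
  have := ler_norm w; move: h3; rewrite ltr_norml => /andP[]; lra.
have h5 : eps / 2 / (`|w| + 1) * v n <= eps / 2.
  have w1 : 0 < `|w| + 1 by rewrite ltr_wpDl.
  apply: (@le_trans _ _ (eps / 2 / (`|w| + 1) * (`|w| + 1))).
    by rewrite ler_wpM2l // ltW.
  by rewrite divfK ?gt_eqF.
have -> : - kap * w - u n = (- kap * w - - kap * v n) - (u n + kap * v n) by ring.
apply: le_lt_trans (ler_normB _ _) _; lra.
Unshelve. all: by end_near. Qed.

End Moments.

(** * The effect of truncation on functions and laws *)

Section Truncation.
Context {R : realType} {M0 M1 : nat}.
Local Notation S := (mg1_state M0 M1).
Local Notation st k i := (existT (fun l => 'I_(level_size M0 M1 l)) k i : S).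
Variable Q : mg1_blocks R M0 M1.
Hypothesis hP : stochastic (mg1_matrix Q).
Hypothesis jump_sq_cvg : forall k i j,
  cvgn (fun n => \sum_(0 <= m < n) m.+1%:R ^+ 2 * jump Q k m.+1 i j).

Let J0 k m i j : 0 <= jump Q k m.+1 i j. Proof. exact: jump_ge0. Qed.

Lemma weighted_jump_cvg k N i j :
  cvgn (fun n => \sum_(N <= m < n) (m - N)%:R * jump Q k m.+1 i j).
Proof.
apply: is_cvg_sum_from; apply: dom_sum_cvg (jump_sq_cvg k i j) => m.
rewrite ger0_norm ?mulr_ge0 // ler_wpM2r // -natrX ler_nat -mulnn; nia.
Qed.

Lemma tail_summable k N : mx_summable N (tail (jump Q k)).
Proof.
apply/mx_summableP => i j; apply: is_cvg_sum_from.
have /cvg_ex[T hT] := weighted_jump_cvg k 0 i j.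
have := @double_tail_cvg _ (fun l => jump Q k l.+1 i j)
  (fun l => tail (jump Q k) l.+1 i j) 0 (fun l => J0 k l i j) _ T hT.
move=> /(_ (fun l => @tail_jump _ _ _ _ hP k l.+1 i j)) h.
apply: (@cvgP _ _ (tail (jump Q k) 0 i j + T)); rewrite -cvg_shiftS /=.
under eq_fun do rewrite big_nat_recl //.
by apply: cvgD => //; exact: cvg_cst.
Qed.

Lemma double_tail_jump k N i j :
  \sum_(N <= m < n) (m - N)%:R * jump Q k m.+1 i j @[n --> \oo] -->
  tail (tail (jump Q k)) N i j.
Proof.
have /cvg_ex[T hT] := weighted_jump_cvg k N i j.
have := @double_tail_cvg _ (fun l => jump Q k l.+1 i j)
  (fun l => tail (jump Q k) l.+1 i j) N (fun l => J0 k l i j) _ T hT.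
move=> /(_ (fun l => @tail_jump _ _ _ _ hP k l.+1 i j)) h.
have := @cvg_mx_sum _ _ _ _ _ (tail_summable k N.+1) i j; rewrite -cvg_shiftS /=.
under eq_fun do rewrite big_add1 /=.
move=> h'; suff <- : T = tail (tail (jump Q k)) N i j by [].
exact: (cvg_unique _ h h').
Qed.

(** The mass moved by truncating at [N], weighted by the number of levels it is
    moved down. *)
Definition excess N (s : S) : R :=
  \sum_j tail (tail (jump Q (tag s))) N.-1 (tagged s) j.

Lemma excess_cvg N k i :
  \sum_(N.-1 <= m < n) (m - N.-1)%:R * \sum_j jump Q k m.+1 i j @[n --> \oo] -->
  excess N (st k i).
Proof.
have : (\sum_j \sum_(N.-1 <= m < n) (m - N.-1)%:R * jump Q k m.+1 i j)
    @[n --> \oo] --> excess N (st k i).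
  by apply: cvg_finsum => j; exact: double_tail_jump.
apply: cvg_trans; apply: near_eq_cvg; near=> n.
by rewrite exchange_big /=; apply: eq_bigr => m _; rewrite mulr_sumr.
Unshelve. all: by end_near. Qed.

Lemma excess_ge0 N s : 0 <= excess N s.
Proof.
case: s => k i; apply: (cvgr_to_ge (excess_cvg N k i)); near=> n.
by apply: sumr_ge0 => m _; rewrite mulr_ge0 //; apply: sumr_ge0.
Unshelve. all: by end_near. Qed.

Lemma excess_cvg0 s : excess N s @[N --> \oo] --> (0 : R).
Proof.
case: s => k i.
have -> : (0 : R) = \sum_(j < M1) 0 by rewrite big1.
apply: cvg_finsum => j.
rewrite -(cvg_shiftS (fun N => tail _ N.-1 i j)) /=.
rewrite (cvg_shiftS (fun N => mx_sum N (tail (jump Q k)) i j)).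
apply: (@sum_tail_cvg0 _ (fun l => tail (jump Q k) l i j)) => l.
exact: @cvg_mx_sum _ _ _ _ _ (tail_summable k l) i j.
Qed.

Lemma slope_telescope (f : S -> R) (kap eps : R) N (j : 'I_M1) :
  (forall l, (N <= l)%N -> `|f (st l.+2 j) - f (st l.+1 j) - kap| <= eps) ->
  forall q m, (N <= q)%N -> (q <= m)%N ->
  `|f (st m.+1 j) - f (st q.+1 j) - kap * (m - q)%:R| <= eps * (m - q)%:R.
Proof.
move=> finc q m Nq /subnK <-; rewrite addnK; elim: (m - q)%N => [|d IH].
  by rewrite add0n subrr !mulr0 subrr normr0.
have := finc (d + q)%N; rewrite (leq_trans Nq (leq_addl _ _)) => /(_ isT).
move: IH; rewrite addSn -natr1 !ler_norml => /andP[h1 h2] /andP[h3 h4].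
by apply/andP; split; lra.
Qed.

(** Mass moved down from level [(k + m).+1] to level [k + N] changes [f] by
    [m - N.-1] increments, each within [eps] of [kap]. *)
Lemma LI_defect (f : S -> R) (kap eps : R) N k i (x y : R) :
  (forall l (j : 'I_M1), (N.-1 <= l)%N ->
     `|f (st l.+2 j) - f (st l.+1 j) - kap| <= eps) ->
  \sum_(N.-1 <= m < n) (\sum_j jump Q k m.+1 i j *
      (f (st (k + m).+1 j) - f (st (k + N.-1).+1 j))) @[n --> \oo] --> x - y ->
  `|x - y - kap * excess N (st k i)| <= eps * excess N (st k i).
Proof.
move=> finc fxy; have ex := excess_cvg N k i.
have term n : `|\sum_(N.-1 <= m < n) (\sum_j jump Q k m.+1 i j *
      (f (st (k + m).+1 j) - f (st (k + N.-1).+1 j))) -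
    kap * (\sum_(N.-1 <= m < n) (m - N.-1)%:R * \sum_j jump Q k m.+1 i j)| <=
    eps * (\sum_(N.-1 <= m < n) (m - N.-1)%:R * \sum_j jump Q k m.+1 i j).
  rewrite !mulr_sumr -sumrB; apply: le_trans (ler_norm_sum _ _ _) _.
  rewrite !big_nat; apply: ler_sum => m /andP[Nm _].
  rewrite !mulr_sumr -sumrB; apply: le_trans (ler_norm_sum _ _ _) _.
  apply: ler_sum => j _.
  have := @slope_telescope f kap eps N.-1 j (fun l => finc l j)
    (k + N.-1)%N (k + m)%N.
  rewrite leq_addl leq_add2l subnDl => /(_ isT Nm) h.
  have -> : jump Q k m.+1 i j * (f (st (k + m).+1 j) - f (st (k + N.-1).+1 j)) -
     kap * ((m - N.-1)%:R * jump Q k m.+1 i j) = jump Q k m.+1 i j *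
     (f (st (k + m).+1 j) - f (st (k + N.-1).+1 j) - kap * (m - N.-1)%:R) by ring.
  rewrite normrM (ger0_norm (J0 _ _ _ _)) mulrA [leRHS]mulrC ler_wpM2l //.
have h1 := cvg_seqB fxy (@cvg_seqZ _ kap _ _ ex).
have h2 := @cvg_seqZ _ eps _ _ ex.
by apply: (ler_cvg_to (cvg_norm h1) h2); near=> n; exact: term.
Unshelve. all: by end_near. Qed.

Lemma tail0_cvg (q : S -> R) : (forall s, 0 <= q s) -> psum q @ \oo --> (1 : R) ->
  forall i : 'I_M1,
  \sum_(0 <= l < n) q (st l.+1 i) @[n --> \oo] --> tail0 q 0 i.
Proof.
move=> q0 q1 i.
have : mx_summable 0 (fun l => level q l.+1 : 'rV[R]_M1).
  apply/mx_summableP => b j; rewrite {b}ord1.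
  under eq_fun do under eq_bigr do rewrite mxE.
  apply: (@nonneg_sum_cvg _ _ _ 1) => // n.
  apply: le_trans (psum_le_lim n.+1 q0 q1).
  rewrite /psum big_nat_recl //= ler_wpDl ?sumr_ge0 //.
  by apply: ler_sum => l _; rewrite (bigD1 j) //= lerDl; apply: sumr_ge0.
move=> /cvg_mx_sum/(_ 0 i).
by under eq_fun do under eq_bigr do rewrite mxE.
Qed.

(** The integral of the excess against [q]. It depends on [q] only through its
    restriction to level 0 and its phase marginal above, since the excess takes
    the same value on all positive levels of a phase. *)
Definition mean_excess (q : S -> R) N : R :=
  \sum_i q (st 0 i) * (tail (tail (blkB Q)) N.-1 *m const_mx 1 : 'cV_M0) i 0 +
  \sum_i tail0 q 0 i * (tail (tail (blkA Q)) N.-1 *m const_mx 1 : 'cV_M1) i 0.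

Lemma mean_excess_cvg (q : S -> R) N : (forall s, 0 <= q s) ->
  psum q @ \oo --> (1 : R) ->
  psum (fun s => q s * excess N s) @ \oo --> mean_excess q N.
Proof.
move=> q0 q1; rewrite -cvg_shiftS /=.
have exB i : (tail (tail (blkB Q)) N.-1 *m const_mx 1 : 'cV_M0) i 0 =
    excess N (st 0 i).
  by rewrite mxE; apply: eq_bigr => j _; rewrite mxE mulr1.
have exA l (i : 'I_M1) : (tail (tail (blkA Q)) N.-1 *m const_mx 1 : 'cV_M1) i 0 =
    excess N (st l.+1 i).
  by rewrite mxE; apply: eq_bigr => j _; rewrite mxE mulr1.
have h : (\sum_(i < M1) (\sum_(0 <= l < n) q (st l.+1 i)) * excess N (st 1 i)) @[n --> \oo]
    --> \sum_i tail0 q 0 i *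
        (tail (tail (blkA Q)) N.-1 *m const_mx 1 : 'cV_M1) i 0.
  apply: cvg_finsum => i; rewrite (exA 0%N); apply: cvgM; last exact: cvg_cst.
  exact: tail0_cvg.
have c0 : (fun n : nat => \sum_i q (st 0 i) * excess N (st 0 i)) @ \oo -->
  \sum_i q (st 0 i) * (tail (tail (blkB Q)) N.-1 *m const_mx 1 : 'cV_M0) i 0.
  under [X in _ --> X]eq_bigr do rewrite exB.
  exact: cvg_cst.
have := cvg_seqD c0 h; rewrite /mean_excess.
apply: cvg_trans; apply: near_eq_cvg; near=> n.
rewrite /psum big_nat_recl //=; congr (_ + _).
under eq_bigr do rewrite mulr_suml.
rewrite exchange_big /=; apply: eq_bigr => l _; apply: eq_bigr => i _.
by rewrite -(exA 0%N) (exA l).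
Unshelve. all: by end_near. Qed.

(** Markov's inequality for the level. *)
Lemma tail0_tight (q : S -> R) (b : R) L (i : 'I_M1) : (forall s, 0 <= q s) ->
  psum q @ \oo --> (1 : R) ->
  (forall n, psum (fun s => q s * (tag s)%:R) n <= b) ->
  0 <= tail0 q 0 i - \sum_(0 <= l < L) q (st l.+1 i) <= b / L.+1%:R.
Proof.
move=> q0 q1 qb; have h := cvg_sum_from (l := L) (tail0_cvg q q0 q1 i).
apply/andP; split.
  by apply: (cvgr_to_ge h); near=> n; apply: sumr_ge0.
apply: (cvg_le_bound h); near=> n.
rewrite ler_pdivlMr // mulr_suml; apply: le_trans (qb n.+1).
rewrite /psum big_nat_recl //= ler_wpDl //.
  by apply: sumr_ge0 => j _; rewrite mulr0.
have [Ln|nL] := leqP L n; last first.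
  by rewrite big_geq ?(ltnW nL) //; do 2![apply: sumr_ge0 => ? _]; rewrite mulr_ge0.
rewrite [leRHS](@big_cat_nat _ _ _ L) //= ler_wpDl //.
  by do 2![apply: sumr_ge0 => ? _]; rewrite mulr_ge0.
rewrite !big_nat; apply: ler_sum => l /andP[Ll _].
rewrite (bigD1 i) //= ler_wpDr //.
  by apply: sumr_ge0 => j _; rewrite mulr_ge0.
by rewrite ler_wpM2l // ler_nat ltnS.
Unshelve. all: by end_near. Qed.

(** A uniform bound on the mean level turns pointwise convergence of laws into
    convergence of their phase marginals over the positive levels. *)
Lemma tail0_cvg_tight (q : S -> R) (qN : nat -> S -> R) (b : R) :
  (forall s, 0 <= q s) -> psum q @ \oo --> (1 : R) ->
  (forall n, psum (fun s => q s * (tag s)%:R) n <= b) ->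
  (forall N, (0 < N)%N -> [/\ forall s, 0 <= qN N s, psum (qN N) @ \oo --> (1 : R)
     & forall n, psum (fun s => qN N s * (tag s)%:R) n <= b]) ->
  (forall s, qN N s @[N --> \oo] --> q s) ->
  forall i, tail0 (qN N) 0 i @[N --> \oo] --> tail0 q 0 i.
Proof.
move=> q0 q1 qb qNP qNq i; apply/cvgrPdist_lt => eps eps0.
pose L := (Num.truncn (4 * b / eps)).+1.
have bL : b / L.+1%:R < eps / 4.
  have : 4 * b / eps < L.+1%:R.
    apply: lt_le_trans (truncnS_gt _) _.
    by rewrite ler_nat.
  rewrite ltr_pdivrMr // => h; rewrite ltr_pdivrMr //; lra.
have fin : \sum_(0 <= l < L) qN N (st l.+1 i) @[N --> \oo] -->
    \sum_(0 <= l < L) q (st l.+1 i).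
  rewrite big_mkord; under eq_fun do rewrite big_mkord.
  by apply: cvg_finsum => l; exact: qNq.
have /cvgrPdist_lt/(_ (eps / 2)) fin' := fin.
near=> N.
have N0 : (0 < N)%N by near: N; exact: nbhs_infty_gt.
have h1 : `|\sum_(0 <= l < L) q (st l.+1 i) -
    \sum_(0 <= l < L) qN N (st l.+1 i)| < eps / 2.
  by near: N; apply: fin'; lra.
have [qN0 qN1 qNb] := qNP N N0.
have := tail0_tight q b L i q0 q1 qb.
have := tail0_tight (qN N) b L i qN0 qN1 qNb.
move: h1 (bL); rewrite !ltr_norml; move: (b / L.+1%:R) (tail0 _ 0 i) => c t.
move: (tail0 _ 0 i) (\sum_(0 <= l < L) _) (\sum_(0 <= l < L) _) => t' u u'.
move=> /andP[h1 h2] h /andP[h3 h4] /andP[h5 h6]; apply/andP; split; lra.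
Unshelve. all: by end_near. Qed.

End Truncation.

(** * The convergence formula *)

Section Estimate.
Context {R : realType} {M0 M1 : nat}.
Local Notation S := (mg1_state M0 M1).
Local Notation st k i := (existT (fun l => 'I_(level_size M0 M1 l)) k i : S).

(** Integrating the Poisson equation of [P] against the stationary law [q] of
    the truncated chain leaves the defect [P h - P^(N) h], which is a multiple of
    the excess up to the error on the slope. *)
Lemma LI_estimate (Q : mg1_blocks R M0 M1) (h : S -> R) (d c kap eps b : R)
    (s0 : S) (N : nat) (q : S -> R) :
  stochastic (mg1_matrix Q) ->
  (forall k i j,
     cvgn (fun n => \sum_(0 <= m < n) m.+1%:R ^+ 2 * jump Q k m.+1 i j)) ->
  linear_growth d h ->
  (forall s, psum (fun t => mg1_matrix Q s t * h t) @ \oo -->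
     h s + (c - (s == s0)%:R)) ->
  (0 < N)%N ->
  (forall l (j : 'I_M1), (N.-1 <= l)%N ->
     `|h (st l.+2 j) - h (st l.+1 j) - kap| <= eps) ->
  stationary (mg1_matrix (LI_blocks Q N)) q ->
  (forall n, psum (fun s => q s * (tag s)%:R) n <= b) ->
  `|q s0 - c + kap * mean_excess Q q N| <= eps * mean_excess Q q N.
Proof.
move=> hP jsq hd hPois N0 slope hq qb.
have hN := LI_stochastic hP N0; have q1 := law_sum1 hq.
have q0 s : 0 <= q s by case: hq.
have /choice[D DP] s : exists D : R,
    psum (fun t => mg1_matrix (LI_blocks Q N) s t * h t) @ \oo -->
      h s + (c - (s == s0)%:R - D) /\
    `|D - kap * excess Q N s| <= eps * excess Q N s.
  case: s => k i; have [y hy def] := LI_row hP N0 (hPois (st k i)).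
  exists (h (st k i) + (c - (st k i == s0)%:R) - y); split.
    have -> : h (st k i) + (c - (st k i == s0)%:R -
      (h (st k i) + (c - (st k i == s0)%:R) - y)) = y by ring.
    exact: hy.
  exact: (LI_defect Q hP jsq h kap eps N k i _ _ slope def).
pose g (s : S) := d * (tag s).+1%:R.
have gd : linear_growth `|d| g.
  by move=> s; rewrite normrM (ger0_norm (x := _%:R)).
have /choice[Pg gP] s : exists x : R,
    psum (fun t => mg1_matrix (LI_blocks Q N) s t * g t) @ \oo --> x.
  case: s => k i.
  have gc := linear_growth_row_cvg Q hP jsq `|d| g (st k i) gd.
  by have [y gy _] := LI_row hP N0 gc; exists y.
have /cvg_ex[x gx] := linear_growth_law_cvg d b q q0 q1 qb.
have H0 := stationary_increment hN hq hd gP gx (fun s => (DP s).1).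
have H1 : psum (fun s => q s * c) @ \oo --> c by exact: (@law_cst _ _ _ _ _ hq c).
have H2 : psum (fun s => q s * (s == s0)%:R) @ \oo --> q s0.
  apply: cvg_near_cst; near=> n; apply: psum_pred1.
  by near: n; exact: nbhs_infty_gt.
have H3 : psum (fun s => q s * D s) @ \oo --> c - q s0 - 0.
  have := cvg_seqB (cvg_seqB H1 H2) H0.
  apply: cvg_trans; apply: near_eq_cvg; near=> n.
  by rewrite -!psumB; apply: eq_psum => s; ring.
rewrite subr0 in H3.
have H4 := mean_excess_cvg Q q N q0 q1.
have H5 := cvg_seqB H3 (@cvg_seqZ _ kap _ _ H4).
have -> : `|q s0 - c + kap * mean_excess Q q N| =
    `|c - q s0 - kap * mean_excess Q q N|.
  by rewrite -normrN; congr (`|_|); ring.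
apply: (ler_cvg_to (cvg_norm H5) (@cvg_seqZ _ eps _ _ H4)); near=> n.
rewrite -!psumZ -psumB; apply: le_trans (ler_norm_psum _ _) _.
apply: le_psum => s.
have -> : q s * D s - kap * (q s * excess Q N s) =
    q s * (D s - kap * excess Q N s) by ring.
have -> : eps * (q s * excess Q N s) = q s * (eps * excess Q N s) by ring.
by rewrite normrM (ger0_norm (q0 s)) ler_wpM2l //; case: (DP s).
Unshelve. all: by end_near. Qed.

End Estimate.

Section ScaleShift.
Context {R : realType}.

(** Passing from [N] to [N.+1] multiplies the scale [r ^- N * f N] by a factor
    that tends to [r^-1]; this is where the factor [r] of the limit arises. *)
Lemma scale_shift_cvg (r : R) (f t : nat -> R) (c : R) : 1 < r ->
  f N / f N.-1 @[N --> \oo] --> (1 : R) ->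
  (r ^- N * f N)^-1 * t N @[N --> \oo] --> c ->
  (r ^- N * f N)^-1 * t N.-1 @[N --> \oo] --> r * c.
Proof.
move=> r1 hf ht; rewrite -cvg_shiftS /=.
have r0 : r != 0 by rewrite gt_eqF //; lra.
have hf' : f N.+1 / f N @[N --> \oo] --> (1 : R) by rewrite -cvg_shiftS in hf.
have hfV : (f N.+1 / f N)^-1 @[N --> \oo] --> (1 : R).
  by rewrite -[X in _ --> X]invr1; apply: cvgV => //; exact: oner_neq0.
have := @cvg_seqZ _ r _ _ ht => h.
have h1 : (r * ((r ^- N * f N)^-1 * t N)) * (f N.+1 / f N)^-1 @[N --> \oo] -->
    r * c * 1 by apply: cvgM.
rewrite mulr1 in h1; apply: cvg_trans h1; apply: near_eq_cvg.
have /cvgrPdist_lt/(_ 1 ltr01) near1 := hf'.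
near=> N.
have : `|1 - f N.+1 / f N| < 1 by near: N.
have [fN0|fN] := eqVneq (f N) 0.
  by rewrite fN0 invr0 mulr0 subr0 normr1 ltxx.
have [fN0|fN' _] := eqVneq (f N.+1) 0.
  by rewrite fN0 mul0r subr0 normr1 ltxx.
have rN : r ^+ N != 0 by rewrite expf_neq0.
rewrite exprS; field.
by rewrite r0 rN fN fN'.
Unshelve. all: by end_near. Qed.

Lemma scale_gt0 (r : R) (f : nat -> R) : 1 < r -> (forall n, 0 <= f n) ->
  f N / f N.-1 @[N --> \oo] --> (1 : R) ->
  \forall N \near \oo, 0 < r ^- N * f N.
Proof.
move=> r1 f0 /cvgrPdist_lt/(_ 1 ltr01) near1; near=> N.
have : `|1 - f N / f N.-1| < 1 by near: N.
have [fN0|fN _] := eqVneq (f N) 0.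
  by rewrite fN0 mul0r subr0 normr1 ltxx.
by rewrite mulr_gt0 ?invr_gt0 ?exprn_gt0 ?lt_def ?fN ?f0 //; lra.
Unshelve. all: by end_near. Qed.

End ScaleShift.
Theorem theorem2p1
  (R : realType) (M0 M1 : nat) (hM0 : (0 < M0)%N) (hM1 : (0 < M1)%N)
  (Q : mg1_blocks R M0 M1)
  (hP : stochastic (mg1_matrix Q))
  (p : mg1_state M0 M1 -> R)
  (hp : stationary (mg1_matrix Q) p)
  (pN : nat -> mg1_state M0 M1 -> R)
  (hpN : forall N, (0 < N)%N ->
     stationary (mg1_matrix (LI_blocks Q N)) (pN N))
  (hirr : irreducible (mg1_matrix Q))
  (hA : irreducible_mx (sumA Q) /\ stochastic_mx (sumA Q))
  (hmB : meanB_finite Q)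
  (varpi : 'rV[R]_M1) (hvarpi : stationary_mx (sumA Q) varpi)
  (hsigma : drift Q varpi < 0)
  (G : 'M[R]_M1) (hG : G_minimal Q G)
  (C : {set 'I_M1}) (hC : closed_comm_class G C)
  (haper : aperiodic_class G C)
  (r : R) (hr : r%:E = Order.min (rA Q) (rB Q)) (hr1 : 1 < r)
  (f : nat -> R) (hf0 : forall n, 0 <= f n)
  (cA : 'cV[R]_M1) (cB : 'cV[R]_M0)
  (hcA0 : mxle 0 cA) (hcB0 : mxle 0 cB) (hc : cA != 0 \/ cB != 0)
  (hcA : (r ^- N * f N)^-1 *: (tail (tail (blkA Q)) N *m const_mx 1)
           @[N --> \oo] --> cA)
  (hcB : (r ^- N * f N)^-1 *: (tail (tail (blkB Q)) N *m const_mx 1)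
           @[N --> \oo] --> cB)
  (hf : f N / f N.-1 @[N --> \oo] --> (1 : R)) :
  forall k : nat,
    let c := r * (level0 p *m cB + tail0 p *m cA) 0 0 / - drift Q varpi in
    (r ^- N * f N)^-1 *: (level (pN N) k - level p k)
      @[N --> \oo] --> c *: level p k
    /\ forall i, 0 < (c *: level p k) 0 i.
Proof.
pose st k (i : 'I_(level_size M0 M1 k)) : mg1_state M0 M1 := existT _ k i.
have [rA1 rB1] : (1%:E < rA Q)%E /\ (1%:E < rB Q)%E.
  have : (1%:E < Order.min (rA Q) (rB Q))%E by rewrite -hr lte_fin.
  by rewrite lt_min => /andP[].
have jsq k i j : cvgn (fun n => \sum_(0 <= m < n) m.+1%:R ^+ 2 * jump Q k m.+1 i j).
  by case: k i j => [|k] i j; [move: rB1 | move: rA1] => /radius_sq_cvg; apply;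
    move=> m i' j'; [exact: (jump_ge0 hP (k := 0)) | exact: (jump_ge0 hP (k := 1))].
have [a [a0 aE]] := drift_corrector hA hvarpi.
have Gs := G_stochastic Q hP jsq hA G hG varpi a a0 aE hsigma.
have Ginc := G_increment_cvg0 Q hP jsq hA G hG varpi a a0 aE hsigma C hC haper.
have [b [pb pNb]] := uniform_mean_level hP jsq hA a0 aE hsigma.
have p0 s : 0 <= p s by case: hp.
have ppos s : 0 < p s by exact: stationary_gt0 hP hp hirr s.
have p1 := law_sum1 hp.
have pN0 N : (0 < N)%N -> forall s, 0 <= pN N s by move=> /hpN[].
have pN1 N : (0 < N)%N -> psum (pN N) @ \oo --> (1 : R).
  by move=> N0; exact: law_sum1 (hpN N N0).
pose del N := r ^- N * f N.
pose sg := drift Q varpi.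
(* the increments of the Poisson solution are within [eps] of the slope from
   some level on *)
have est s0 eps : 0 < eps -> \forall N \near \oo,
    `|pN N s0 - p s0 + p s0 / sg * mean_excess Q (pN N) N|
      <= eps * mean_excess Q (pN N) N.
  move=> eps0.
  have [h [d [hd hPois hinc]]] := poisson_solution Q hP jsq hirr hA p hp varpi a
    a0 aE hsigma G Gs hG Ginc s0.
  have slope : \forall l \near \oo, forall j : 'I_M1,
      `|p s0 / sg - (h (st l.+2 j) - h (st l.+1 j))| < eps.
    apply: filter_forall => j.
    by have /cvgrPdist_lt := hinc j; apply.
  case: slope => L _ slope; near=> N.
  have N0 : (0 < N)%N by near: N; exact: nbhs_infty_gt.
  have LN : (L < N)%N by near: N; exact: nbhs_infty_gt.
  apply: (LI_estimate Q h d (p s0) (p s0 / sg) eps b s0 N) => //.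
  - move=> l j Nl; rewrite distrC ltW //; apply: slope => /=.
    lia.
  - exact: hpN.
  - exact: pNb (hpN N N0).
have tail0_ge0 (q : mg1_state M0 M1 -> R) : (forall s, 0 <= q s) -> psum q @ \oo --> (1 : R) ->
    forall i, 0 <= tail0 q 0 i :> R.
  move=> q0 q1 i; apply: (cvgr_to_ge (tail0_cvg q q0 q1 i)); near=> n.
  exact: sumr_ge0.
have tail0_le1 (q : mg1_state M0 M1 -> R) : (forall s, 0 <= q s) -> psum q @ \oo --> (1 : R) ->
    forall i, tail0 q 0 i <= 1 :> R.
  move=> q0 q1 i; apply: (cvg_le_bound (tail0_cvg q q0 q1 i)); near=> n.
  apply: le_trans (psum_le_lim n.+1 q0 q1).
  rewrite /psum big_nat_recl //= ler_wpDl ?sumr_ge0 //.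
  by apply: ler_sum => l _; rewrite (bigD1 i) //= lerDl; apply: sumr_ge0.
pose tB N i := (tail (tail (blkB Q)) N *m const_mx 1 : 'cV_M0) i 0.
pose tA N i := (tail (tail (blkA Q)) N *m const_mx 1 : 'cV_M1) i 0.
have tBE N i : tB N.-1 i = excess Q N (st 0%N i).
  by rewrite /tB mxE; apply: eq_bigr => j _; rewrite mxE mulr1.
have tAE N i : tA N.-1 i = excess Q N (st 1%N i).
  by rewrite /tA mxE; apply: eq_bigr => j _; rewrite mxE mulr1.
have mE q N : mean_excess Q q N = \sum_i q (st 0%N i) * tB N.-1 i
    + \sum_i tail0 q 0 i * tA N.-1 i by [].
have mean_excess0 : mean_excess Q (pN N) N @[N --> \oo] --> (0 : R).
  have bound : \sum_i excess Q N (st 0%N i) + \sum_i excess Q N (st 1%N i)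
      @[N --> \oo] --> (0 : R).
    rewrite -[X in _ --> X]addr0; apply: cvg_seqD.
      rewrite [X in _ --> X](_ : 0 = \sum_(i < M0) 0); last by rewrite big1.
      by apply: cvg_finsum => i; exact: (excess_cvg0 Q hP jsq).
    rewrite [X in _ --> X](_ : 0 = \sum_(i < M1) 0); last by rewrite big1.
    by apply: cvg_finsum => i; exact: (excess_cvg0 Q hP jsq).
  apply: (squeeze_cvgr _ (cvg_cst 0) bound); near=> N.
  have N0 : (0 < N)%N by near: N; exact: nbhs_infty_gt.
  have q0 := pN0 N N0; have q1 := pN1 N N0.
  have t0 := tail0_ge0 (pN N) q0 q1.
  rewrite mE; apply/andP; split.
    by apply: addr_ge0; apply: sumr_ge0 => i _;
      rewrite ?tBE ?tAE mulr_ge0 ?(excess_ge0 Q hP jsq).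
  apply: lerD; apply: ler_sum => i _; rewrite ?tBE ?tAE ler_piMl ?(excess_ge0 Q hP jsq) //.
    exact: law_le1 (hpN N N0) _.
  exact: tail0_le1.
have pNp s : pN N s @[N --> \oo] --> p s.
  have := cvg_relative (fun N => pN N s - p s) _ (p s / sg) 0 mean_excess0 (est s).
  rewrite mulr0 => h; rewrite -[X in _ --> X]add0r.
  have ps : (fun _ : nat => p s) @ \oo --> p s by exact: cvg_cst.
  by have := cvg_seqD h ps; under eq_fun do rewrite subrK.
(* pointwise convergence alone would allow mass to escape to infinity *)
have tail0p := tail0_cvg_tight p pN b p0 p1 (pb p hp) _ pNp.
have {}tail0p i : tail0 (pN N) 0 i @[N --> \oo] --> tail0 p 0 i.
  by apply: tail0p => N N0; split; [exact: pN0 | exact: pN1 | exact: pNb (hpN N N0)].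
have sB i : (del N)^-1 * tB N.-1 i @[N --> \oo] --> r * cB i 0.
  apply: (scale_shift_cvg r f (fun N => tB N i) _ hr1 hf).
  by have /cvg_mxP/(_ i 0) := hcB; under eq_fun do rewrite mxE.
have sA i : (del N)^-1 * tA N.-1 i @[N --> \oo] --> r * cA i 0.
  apply: (scale_shift_cvg r f (fun N => tA N i) _ hr1 hf).
  by have /cvg_mxP/(_ i 0) := hcA; under eq_fun do rewrite mxE.
pose X := (level0 p *m cB + tail0 p *m cA) 0 0.
have XE : X = \sum_i p (st 0%N i) * cB i 0 + \sum_i tail0 p 0 i * cA i 0.
  by rewrite /X !mxE; congr (_ + _); apply: eq_bigr => i _; rewrite mxE.
have scaled : (del N)^-1 * mean_excess Q (pN N) N @[N --> \oo] --> r * X.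
  have -> : r * X = \sum_i p (st 0%N i) * (r * cB i 0)
      + \sum_i tail0 p 0 i * (r * cA i 0).
    rewrite XE mulrDr !mulr_sumr; congr (_ + _); apply: eq_bigr => i _; ring.
  have hB i : pN N (st 0%N i) * ((del N)^-1 * tB N.-1 i) @[N --> \oo] -->
      p (st 0%N i) * (r * cB i 0) by apply: cvgM; [exact: pNp | exact: sB].
  have hA' i : tail0 (pN N) 0 i * ((del N)^-1 * tA N.-1 i) @[N --> \oo] -->
      tail0 p 0 i * (r * cA i 0) by apply: cvgM; [exact: tail0p | exact: sA].
  have := cvg_seqD (cvg_finsum hB) (cvg_finsum hA').
  apply: cvg_trans; apply: near_eq_cvg; near=> N.
  rewrite mE mulrDr !mulr_sumr; congr (_ + _); apply: eq_bigr => i _ /=; ring.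
have lim s : (del N)^-1 * (pN N s - p s) @[N --> \oo] --> - (p s / sg) * (r * X).
  apply: (cvg_relative _ _ (p s / sg) (r * X) scaled) => eps eps0.
  have del0 := scale_gt0 r f hr1 hf0 hf; have es := est s eps eps0.
  near=> N.
  have d0 : 0 < (del N)^-1 by rewrite invr_gt0; near: N.
  have e : `|pN N s - p s + p s / sg * mean_excess Q (pN N) N|
      <= eps * mean_excess Q (pN N) N by near: N.
  rewrite [p s / sg * _]mulrCA -mulrDr normrM (gtr0_norm d0) [leRHS]mulrCA.
  by rewrite ler_pM2l.
move=> k c.
have sg0 : 0 < - sg by rewrite oppr_gt0.
have cE s : - (p s / sg) * (r * X) = c * p s.
  by rewrite /c -/X -/sg invrN; ring.
(* positivity: every state has positive stationary mass, and [cA] or [cB] has a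
   positive entry *)
have X0 : 0 < X.
  have tp i : 0 < tail0 p 0 i.
    apply: lt_le_trans (ppos (st 1%N i)) _.
    have := nonneg_sum_le 1 (fun l => p0 (st l.+1 i)) (tail0_cvg p p0 p1 i).
    by rewrite big_nat1.
  have cB0 i : 0 <= cB i 0 by have := hcB0 i 0; rewrite mxE.
  have cA0 i : 0 <= cA i 0 by have := hcA0 i 0; rewrite mxE.
  have sB0 : 0 <= \sum_i p (st 0%N i) * cB i 0 by apply: sumr_ge0 => i _; rewrite mulr_ge0.
  have sA0 : 0 <= \sum_i tail0 p 0 i * cA i 0.
    by apply: sumr_ge0 => i _; rewrite mulr_ge0 // ltW.
  rewrite XE lt_def addr_ge0 // andbT paddr_eq0 //.
  apply/negP => /andP[zB zA]; case: hc => /eqP; apply; apply/matrixP => i j;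
    rewrite mxE ord1.
    move: zA; rewrite psumr_eq0 => [|l _]; last by rewrite mulr_ge0 // ltW.
    move=> /allP/(_ i); rewrite mem_index_enum => /(_ isT).
    by rewrite mulf_eq0 gt_eqF //= => /eqP.
  move: zB; rewrite psumr_eq0 => [|l _]; last by rewrite mulr_ge0.
  move=> /allP/(_ i); rewrite mem_index_enum => /(_ isT).
  by rewrite mulf_eq0 gt_eqF //= => /eqP.
split.
  apply/cvg_mxP => i j; rewrite ord1 !mxE -cE.
  by under eq_fun do rewrite !mxE; exact: lim.
move=> i; rewrite !mxE mulr_gt0 // /c divr_gt0 // mulr_gt0 //; lra.
Unshelve. all: by end_near. Qed.
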